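(* Let $d\in\{1,2,3,4\}$ and let $\mathbf{K}$ be a smooth $\mathbf{o}$-symmetric convex body in $\mathbb{E}^d$. Then there is a constant $f(\mathbf{K})>0$, depending on $\mathbf{K}$ only, such that $$c_{\rm sep}(\mathbf{K},n)\leq dn-n^{(d-1)/d}f(\mathbf{K})$$ for all integers $n>1$. In particular, if $\mathbf{K}$ is a smooth $\mathbf{o}$-symmetric convex domain in $\mathbb{E}^2$ (i.e. a smooth $\mathbf{o}$-symmetric convex body in $\mathbb{E}^2$), then $$c_{\rm sep}(\mathbf{K},n)\leq 2n-\frac{\sqrt{\pi}}{8}\sqrt{n}$$ holds for all integers $n>1$.
   Context: $\mathbb{E}^d$ is $d$-dimensional Euclidean space with origin $\mathbf{o}$. A convex body is a compact convex subset of $\mathbb{E}^d$ with nonempty interior. It is $\mathbf{o}$-symmetric if $\mathbf{K}=-\mathbf{K}$, and smooth if at every boundary point it is supported by a unique hyperplane. A packing of translates of $\mathbf{K}$ is a family of translates with pairwise disjoint interiors; two members touch if they intersect. A packing of translates of $\mathbf{K}$ is totally separable if any two members can be separated by a hyperplane of $\mathbb{E}^d$ that is disjoint from the interior of every member of the packing. The contact graph of a packing is the simple graph whose vertices are the members of the packing, two vertices being joined by an edge if and only if the two members touch. The contact number of a packing is the number of edges of its contact graph. For an $\mathbf{o}$-symmetric convex body $\mathbf{K}$ and a positive integer $n$, $c_{\rm sep}(\mathbf{K},n)$ denotes the largest contact number of a totally separable packing of $n$ translates of $\mathbf{K}$. *)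

(* Defs.v *)
From HB Require Import structures.
From mathcomp Require Import all_boot all_order all_algebra.
From mathcomp Require Import boolp classical_sets functions reals.
From mathcomp Require Import topology normedtype convex exp trigo.

Set Implicit Arguments.
Unset Strict Implicit.
Unset Printing Implicit Defensive.

Import Order.TTheory GRing.Theory Num.Theory.
Import numFieldNormedType.Exports.

Local Open Scope classical_set_scope.
Local Open Scope ring_scope.

(* E^d is the space 'rV[R]_d of row vectors with the dot product below; only
   its topology is used, and the library's sup-norm topology on 'rV[R]_d is
   the Euclidean one. *)
Definition dot (R : realType) (d : nat) (u x : 'rV[R]_d) : R :=
  \sum_(i < d) u ord0 i * x ord0 i.

Definition hyperplane (R : realType) (d : nat) (u : 'rV[R]_d) (a : R)
  : set 'rV[R]_d := [set x | dot u x = a].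

Definition convex_body (R : realType) (d : nat) (K : set 'rV[R]_d) : Prop :=
  [/\ compact K, @convex_set R 'rV[R]_d K & K° !=set0].

Definition o_symmetric (R : realType) (d : nat) (K : set 'rV[R]_d) : Prop :=
  K = [set - x | x in K].

Definition supporting_hyperplane (R : realType) (d : nat)
    (K : set 'rV[R]_d) (x : 'rV[R]_d) (H : set 'rV[R]_d) : Prop :=
  exists (u : 'rV[R]_d) (a : R),
    [/\ u != 0, H = hyperplane u a, H x & K `<=` [set y | dot u y <= a]].

(* Uniqueness is that of the hyperplane as a set, the pair (u, a) being
   determined only up to a scalar factor. *)
Definition smooth (R : realType) (d : nat) (K : set 'rV[R]_d) : Prop :=
  forall x, (closure K `\` K°) x -> exists! H, supporting_hyperplane K x H.

Definition translate (R : realType) (d : nat) (K : set 'rV[R]_d)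
    (v : 'rV[R]_d) : set 'rV[R]_d := [set v + x | x in K].

(* A family of n translates of K is given by its translation vectors c. *)
Definition packing (R : realType) (d n : nat) (K : set 'rV[R]_d)
    (c : 'I_n -> 'rV[R]_d) : Prop :=
  trivIset setT (fun i => (translate K (c i))°).

Definition separates (R : realType) (d : nat) (u : 'rV[R]_d) (a : R)
    (A B : set 'rV[R]_d) : Prop :=
  A `<=` [set x | dot u x <= a] /\ B `<=` [set x | a <= dot u x].

Definition totally_separable (R : realType) (d n : nat) (K : set 'rV[R]_d)
    (c : 'I_n -> 'rV[R]_d) : Prop :=
  forall i j : 'I_n, i != j ->
  exists (u : 'rV[R]_d) (a : R),
    [/\ u != 0, separates u a (translate K (c i)) (translate K (c j))
      & forall k : 'I_n, hyperplane u a `&` (translate K (c k))° = set0].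

Definition totally_separable_packing (R : realType) (d n : nat)
    (K : set 'rV[R]_d) (c : 'I_n -> 'rV[R]_d) : Prop :=
  packing K c /\ totally_separable K c.

Definition touch (R : realType) (d n : nat) (K : set 'rV[R]_d)
    (c : 'I_n -> 'rV[R]_d) (i j : 'I_n) : Prop :=
  translate K (c i) `&` translate K (c j) !=set0.

(* The edge {i, j} is represented by the pair (i, j) with i < j. *)
Definition contact_edges (R : realType) (d n : nat) (K : set 'rV[R]_d)
    (c : 'I_n -> 'rV[R]_d) : {set 'I_n * 'I_n} :=
  finset (fun p : 'I_n * 'I_n => (p.1 < p.2)%N && `[< touch K c p.1 p.2 >]).

Definition contact_number (R : realType) (d n : nat) (K : set 'rV[R]_d)
    (c : 'I_n -> 'rV[R]_d) : nat := #|contact_edges K c|.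

(* The maximum is taken over the finitely many graphs on 'I_n that are contact
   graphs of totally separable packings of n translates of K; by the two lemmas
   that follow it is the largest contact number. *)
Definition csep (R : realType) (d : nat) (K : set 'rV[R]_d) (n : nat) : nat :=
  \max_(E : {set 'I_n * 'I_n} |
        `[< exists2 c : 'I_n -> 'rV[R]_d,
              totally_separable_packing K c & contact_edges K c = E >]) #|E|.

Lemma contact_number_le_csep (R : realType) (d n : nat) (K : set 'rV[R]_d)
    (c : 'I_n -> 'rV[R]_d) :
  totally_separable_packing K c -> (contact_number K c <= csep K n)%N.
Proof.
move=> cK; rewrite /contact_number /csep.
apply: (@leq_bigmax_cond _ _ (fun E : {set 'I_n * 'I_n} => #|E|)).
by apply/asboolP; exists c.
Qed.

Lemma csep_attained (R : realType) (d n : nat) (K : set 'rV[R]_d)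
    (c0 : 'I_n -> 'rV[R]_d) :
  totally_separable_packing K c0 ->
  exists2 c : 'I_n -> 'rV[R]_d,
    totally_separable_packing K c & contact_number K c = csep K n.
Proof.
move=> c0K.
pose P (E : {set 'I_n * 'I_n}) := `[< exists2 c : 'I_n -> 'rV[R]_d,
  totally_separable_packing K c & contact_edges K c = E >].
have P0 : (0 < #|P|)%N.
  by apply/card_gt0P; exists (contact_edges K c0); apply/asboolP; exists c0.
have [E /asboolP[c cK cE] maxE] :=
  eq_bigmax_cond (fun E : {set 'I_n * 'I_n} => #|E|) P0.
by exists c => //; rewrite /contact_number cE -maxE; apply: eq_bigl.
Qed.

(* Main.v *)
Require Import Defs.
From HB Require Import structures.
From mathcomp Require Import all_boot all_order all_algebra.
From mathcomp Require Import boolp reals exp.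
From mathcomp Require Import zify ring lra.

Set Implicit Arguments.
Unset Strict Implicit.
Unset Printing Implicit Defensive.

Import Order.TTheory GRing.Theory Num.Theory.
Local Open Scope ring_scope.

(** Let the norm with unit ball K measure lengths, and call a linear functional
    of dual norm one a unit functional.  When two members of a totally
    separable packing touch, the separating hyperplane must be the common
    supporting hyperplane at the contact point; smoothness makes it unique, so
    every contact (v, p) carries one unit functional f_p, equal to 1 at the
    direction x_p = (c_p - c_v) / 2.  No member of the packing may be cut by
    that hyperplane, which forces f_p(x_q) to be nonpositive for the other
    neighbours q of v.  Hence the matrix f_p(x_q), over the neighbours of v, has
    unit diagonal, off-diagonal entries in [-1, 0] and rank at most d, and an
    entry -1 means f_q = - f_p.

    For d at most 4 such a matrix has size at most 2d, and size 2d forces a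
    cross-polytope: the neighbours come in opposite pairs, and d of them form a
    basis dual to their functionals (obtuse_cross_polytope).  The reason is
    that the positive part of a linear dependency between the x_p, if nonempty,
    either contains an opposite pair or has at least 3 elements
    (card_pos_dependency).  An opposite pair +-x leaves all other directions in
    the kernel of one functional, so the dimension drops by one.  Without
    opposite pairs a dependency with both signs involves at least 6 vectors,
    which is too many in dimension at most 4.

    So the contact graph has maximal degree at most 2d.  Call a vertex full if
    its degree is 2d; it remains to see that at least a constant times
    n^((d-1)/d) vertices are not full.  Adjacent full vertices have the same 2d directions
    (directions_full_adj).  Group the full vertices by their set of directions.
    The directions of a group give coordinates on the space, and a member of
    the group that is extremal on its line parallel to a coordinate axis must
    have a neighbour that is not full (extremal_open_nbr).  A finite set of m
    points in dimension d has at least m^((d-1)/d) points that are uppermost on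
    an axis-parallel line, counted with the axes (tops_isoperimetry), an
    elementary isoperimetric inequality proved by slicing; the lowest points
    give as many again.  As t^((d-1)/d) is subadditive, N full vertices have at
    least 2 N^((d-1)/d) edges to the b = n - N others, which have at most
    (2d-1) b edges.  Together with 2 e <= 2dn - b for the number e of contacts
    this gives the first bound; in the plane it gives b >= sqrt n / 2, hence
    e <= 2n - sqrt n / 4, which is enough as pi <= 4. *)

(** * Obtuse systems of functionals and vectors *)

Lemma exists_subset_card (V : finType) (S : {set V}) (k : nat) :
  (k <= #|S|)%N -> exists2 T : {set V}, T \subset S & #|T| = k.
Proof.
move=> /card_geqP[s [us ss sS]]; exists [set:: s].
  by apply/subsetP => i; rewrite inE => /sS.
by rewrite cardsE -ss; apply/card_uniqP.
Qed.

(** For neighbours i, j of a vertex, [A i j] is the value of the functional of i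
    at the direction of j; only these values matter in this part.  The last
    field reflects smoothness: a functional that attains -1 at the direction of
    j is opposite to the functional of j. *)
Record obtuse_system (R : realFieldType) (V : finType) (A : V -> V -> R)
    (S : {set V}) : Prop := ObtuseSystem {
  obtuse_diag : forall i, i \in S -> A i i = 1;
  obtuse_le0 : forall i j, i \in S -> j \in S -> i != j -> A i j <= 0;
  obtuse_geN1 : forall i j, i \in S -> j \in S -> -1 <= A i j;
  obtuse_opp : forall i j, i \in S -> j \in S -> A i j = -1 ->
    forall k, k \in S -> A j k = - A i k }.

Definition dependency (R : realFieldType) (V : finType) (A : V -> V -> R)
    (S T : {set V}) (v : V -> R) : Prop :=
  (forall i, i \notin T -> v i = 0) /\
  (forall i, i \in S -> \sum_j A i j * v j = 0).

(** The rank of A on S is at most r, expressed by dependencies so that it can be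
    passed on to subsets of S without reindexing a matrix. *)
Definition rank_le (R : realFieldType) (V : finType) (A : V -> V -> R)
    (S : {set V}) (r : nat) : Prop :=
  forall T : {set V}, T \subset S -> (r < #|T|)%N ->
  exists2 v, dependency A S T v & exists i, v i != 0.

Definition opp_free (R : realFieldType) (V : finType) (A : V -> V -> R)
    (S : {set V}) : Prop :=
  forall i j, i \in S -> j \in S -> A i j != -1.

Lemma dependency_comb (R : realFieldType) (V : finType) (A : V -> V -> R)
    (S T : {set V}) (v w : V -> R) (a b : R) :
  dependency A S T v -> dependency A S T w ->
  dependency A S T (fun i => a * v i + b * w i).
Proof.
move=> [v0 vA] [w0 wA]; split=> [i iT|i iS].
  by rewrite v0 // w0 // !mulr0 addr0.
under eq_bigr => j _ do rewrite mulrDr !(mulrCA (A i j)).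
by rewrite big_split /= -!mulr_sumr vA // wA // !mulr0 addr0.
Qed.

Lemma dependencyN (R : realFieldType) (V : finType) (A : V -> V -> R)
    (S T : {set V}) (v : V -> R) :
  dependency A S T v -> dependency A S T (fun i => - v i).
Proof.
move=> [v0 vA]; split=> [i iT|i iS]; first by rewrite v0 // oppr0.
under eq_bigr => j _ do rewrite mulrN.
by rewrite sumrN vA // oppr0.
Qed.

Lemma dependencyS (R : realFieldType) (V : finType) (A : V -> V -> R)
    (S T T' : {set V}) (v : V -> R) :
  T \subset T' -> dependency A S T v -> dependency A S T' v.
Proof.
move=> TT' [v0 vA]; split=> // i iT'; apply: v0.
by apply: contra iT'; apply: (subsetP TT').
Qed.

Lemma dependency_in (R : realFieldType) (V : finType) (A : V -> V -> R)
    (S T : {set V}) (v : V -> R) i :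
  dependency A S T v -> v i != 0 -> i \in T.
Proof. by move=> [v0 _]; apply: contraNT => /v0 ->. Qed.

(** Evaluate the dependency with the functional of the index i of largest
    coefficient: the negative coefficients contribute nonnegatively, so the
    other positive ones must outweigh [v i].  A single one can do this only if
    its coefficient equals [v i] and its entry is -1, an opposite pair. *)
Lemma card_pos_dependency (R : realFieldType) (V : finType) (A : V -> V -> R)
    (S : {set V}) (v : V -> R) (a : V) :
  obtuse_system A S -> opp_free A S -> dependency A S S v -> 0 < v a ->
  (3 <= #|[set i | (0 < v i)%R]|)%N.
Proof.
move=> sA freeA dv va.
pose P := [set i | 0 < v i].
have PS i : i \in P -> i \in S.
  by rewrite inE => vi; apply: (dependency_in dv); rewrite gt_eqF.
have aP : a \in P by rewrite inE.
have [i iP vmax] : exists2 i, i \in P & forall j, j \in P -> v j <= v i.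
  by case: (arg_maxP v aP) => i iP vi; exists i.
have iS := PS i iP.
have vi : 0 < v i by move: iP; rewrite inE.
rewrite ltnNge; apply/negP => P2.
have eq0 := dv.2 i iS.
have neg_ge0 : 0 <= \sum_(j | j \notin P) A i j * v j.
  apply: sumr_ge0 => j jP.
  have [jS|jS] := boolP (j \in S); last by rewrite dv.1 // mulr0.
  apply: mulr_le0; last by move: jP; rewrite inE -leNgt.
  by apply: (obtuse_le0 sA iS jS); apply: contraNneq jP => <-.
move: eq0; rewrite (bigID (mem P)) /= (bigD1 i) //= (obtuse_diag sA) // mul1r.
have Pi1 : (#|P :\ i| <= 1)%N by move: P2; rewrite -/P (cardsD1 i P) iP; lia.
have [Pi0|[j jP]] := set_0Vmem (P :\ i).
  rewrite big1 => [|j /andP[jP ji]]; first by lra.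
  by have := in_set0 j; rewrite -Pi0 in_setD1 ji jP.
have Pij : P :\ i = [set j].
  by apply/esym/eqP; rewrite eqEcard sub1set jP cards1.
have [ji jP'] : j != i /\ j \in P by move: jP; rewrite in_setD1 => /andP[].
rewrite (eq_bigl (pred1 j)); last first.
  by move=> k; rewrite /= andbC -in_setD1 Pij inE.
rewrite big_pred1_eq => eq0.
have vj : 0 < v j by move: jP'; rewrite inE.
have jS := PS j jP'.
have Aij : A i j = -1.
  have := obtuse_geN1 sA iS jS; have := vmax j jP'.
  by nra.
by have := freeA i j iS jS; rewrite Aij eqxx.
Qed.

Lemma card_mixed_dependency (R : realFieldType) (V : finType) (A : V -> V -> R)
    (S T : {set V}) (v : V -> R) (a b : V) :
  obtuse_system A S -> opp_free A S -> T \subset S ->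
  dependency A S T v -> 0 < v a -> v b < 0 -> (6 <= #|T|)%N.
Proof.
move=> sA freeA TS dv va vb.
have p3 := card_pos_dependency sA freeA (dependencyS TS dv) va.
have n3 : (3 <= #|[set i | (v i < 0)%R]|)%N.
  have vb' : 0 < - v b by rewrite oppr_gt0.
  have := card_pos_dependency sA freeA (dependencyN (dependencyS TS dv)) vb'.
  by move=> /leq_trans; apply; apply/subset_leq_card/subsetP => i; rewrite !inE oppr_gt0.
have sub : [set i | 0 < v i] :|: [set i | v i < 0] \subset T.
  apply/subsetP => i; rewrite !inE => vi.
  by apply: (dependency_in dv); rewrite neq_lt orbC.
apply: leq_trans (subset_leq_card sub).
rewrite cardsU disjoint_setI0 ?cards0; first by lia.
apply/pred0P => i /=; rewrite !inE.
by apply/negP => /andP[]; lra.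
Qed.

Lemma nonneg_dependency (R : realFieldType) (V : finType) (A : V -> V -> R)
    (S T : {set V}) (r : nat) :
  obtuse_system A S -> opp_free A S -> rank_le A S r ->
  T \subset S -> (r < #|T|)%N -> (#|T| < 6)%N ->
  exists v, [/\ dependency A S T v, forall i, 0 <= v i & exists i, 0 < v i].
Proof.
move=> sA freeA corA TS rT T6; have [v dv [i vi]] := corA T TS rT.
have [[j vj]|nneg] := pselect (exists j, v j < 0); last first.
  have v0 j : 0 <= v j by rewrite leNgt; apply/negP => vj; apply: nneg; exists j.
  by exists v; split=> //; exists i; rewrite lt_neqAle eq_sym vi v0.
exists (fun i => - v i); split; first exact: dependencyN.
  move=> k; rewrite oppr_ge0 leNgt; apply/negP => vk.
  by have := card_mixed_dependency sA freeA TS dv vk vj; lia.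
by exists j; rewrite oppr_gt0.
Qed.

(** Eliminating k between the two dependencies leaves one with both signs,
    supported in U without k, hence with at least 6 elements. *)
Lemma card_elimination (R : realFieldType) (V : finType) (A : V -> V -> R)
    (S U : {set V}) (v w : V -> R) (k a b : V) :
  obtuse_system A S -> opp_free A S -> U \subset S ->
  dependency A S U v -> dependency A S U w ->
  0 < v k -> 0 < w k -> 0 < v a -> w a = 0 -> v b = 0 -> 0 < w b ->
  (7 <= #|U|)%N.
Proof.
move=> sA freeA US dv dw vk wk va wa vb wb.
pose u i := w k * v i + (- v k) * w i.
have [_ uA] : dependency A S U u by exact: dependency_comb.
have kU : k \in U by apply: (dependency_in dv); rewrite gt_eqF.
have du : dependency A S (U :\ k) u.
  split=> // i; rewrite in_setD1 negb_and negbK => /orP[/eqP ->|iU].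
    by rewrite /u; ring.
  by rewrite /u (dv.1 i) // (dw.1 i) // !mulr0 addr0.
have ua : 0 < u a by rewrite /u wa mulr0 addr0 mulr_gt0.
have ub : u b < 0 by rewrite /u vb mulr0 add0r mulNr oppr_lt0 mulr_gt0.
have := card_mixed_dependency sA freeA (subset_trans (subD1set _ _) US) du ua ub.
by rewrite (cardsD1 k U) kU.
Qed.

(** Any r + 2 of the vectors are affinely dependent, and a dependency with sum
    zero has both signs; it would need 6 elements. *)
Lemma card_opp_free_le3 (R : realFieldType) (V : finType) (A : V -> V -> R)
    (S : {set V}) (r : nat) :
  obtuse_system A S -> opp_free A S -> rank_le A S r -> (r <= 3)%N ->
  (#|S| <= r.+1)%N.
Proof.
move=> sA freeA corA r3; rewrite leqNgt; apply/negP => rS.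
have [T TS cT] := exists_subset_card rS.
have nonneg a : a \in T -> exists v, [/\ dependency A S (T :\ a) v,
    forall i, 0 <= v i & exists i, 0 < v i].
  move=> aT; have cTa : #|T :\ a| = r.+1 by move: cT; rewrite (cardsD1 a) aT; lia.
  apply: (nonneg_dependency sA freeA corA); rewrite ?cTa //; last lia.
  exact: subset_trans (subD1set _ _) TS.
have /card_gt0P[a aT] : (0 < #|T|)%N by rewrite cT.
have [v [dv v0 [b vb]]] := nonneg a aT.
have /(dependencyS (subD1set T a)) dvT := dv.
have bT : b \in T by apply: (dependency_in dvT); rewrite gt_eqF.
have [w [dw w0 [e we]]] := nonneg b bT.
have /(dependencyS (subD1set T b)) dwT := dw.
have wb : w b = 0 by apply: dw.1; rewrite setD11.
have sum_gt0 (z : V -> R) i : (forall j, 0 <= z j) -> 0 < z i -> 0 < \sum_j z j.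
  move=> z0 zi; rewrite (bigD1 i) //= ltr_wpDr // sumr_ge0 //.
have sv := sum_gt0 v b v0 vb; have sw := sum_gt0 w e w0 we.
(* The combination of v and w with coefficient sum zero. *)
pose u i := (\sum_j w j) * v i + (- \sum_j v j) * w i.
have du : dependency A S T u by exact: dependency_comb.
have su : \sum_j u j = 0.
  by rewrite big_split /= -!mulr_sumr mulNr mulrC subrr.
have ub : 0 < u b by rewrite /u wb mulr0 addr0 mulr_gt0.
have [[i ui]|u0] := pselect (exists i, u i < 0).
  by have := card_mixed_dependency sA freeA TS du ub ui; rewrite cT; clear -r3; lia.
have : 0 < \sum_j u j.
  apply: (sum_gt0 _ b) => // j; rewrite leNgt; apply/negP => uj.
  by apply: u0; exists j.
by rewrite su ltxx.
Qed.

(** Affine dependencies do not suffice here: six points of a cyclic polytope in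
    dimension 4 only have Radon partitions into 3 + 3.  Any 5 of the vectors
    support a circuit, meaning here a nonnegative dependency.  By elimination,
    two circuits that meet, neither support containing the other, together use
    at least 7 vectors.  If there were 7 vectors, a smallest circuit C,
    partially exchanged with vectors from outside, would contradict this,
    unless C and some vectors outside C form two disjoint circuits of size 3;
    then a circuit on two vectors of each and a seventh one meets one of them. *)
Lemma card_opp_free4 (R : realFieldType) (V : finType) (A : V -> V -> R)
    (S : {set V}) :
  obtuse_system A S -> opp_free A S -> rank_le A S 4 -> (#|S| <= 6)%N.
Proof.
move=> sA freeA corA; rewrite leqNgt; apply/negP => S7.
pose supp (v : V -> R) := [set i | 0 < v i].
pose circuit v := [/\ dependency A S (supp v) v, forall i, 0 <= v i,
  supp v \subset S & (0 < #|supp v|)%N].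
have circuit_in (T : {set V}) : T \subset S -> #|T| = 5 ->
    exists2 v, circuit v & supp v \subset T.
  move=> TS cT.
  have [||v [dv v0 [i vi]]] := nonneg_dependency sA freeA corA TS; rewrite ?cT //.
  have vT : supp v \subset T.
    apply/subsetP => j; rewrite inE => vj.
    by apply: (dependency_in dv); rewrite gt_eqF.
  exists v => //; split=> //; last by apply/card_gt0P; exists i; rewrite inE.
    split=> [j|]; last by case: dv.
    by rewrite inE -leNgt => vj; apply/eqP; rewrite eq_le vj v0.
  exact: subset_trans TS.
have circuit3 v : circuit v -> (3 <= #|supp v|)%N.
  move=> [dv v0 vS /card_gt0P[i]]; rewrite inE => vi.
  exact: card_pos_dependency sA freeA (dependencyS vS dv) vi.
have eq0 v i : circuit v -> i \notin supp v -> v i = 0.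
  by move=> [[v0 _] _ _ _]; apply: v0.
have union v w : circuit v -> circuit w -> supp v :&: supp w != set0 ->
    ~~ (supp v \subset supp w) -> ~~ (supp w \subset supp v) ->
    (7 <= #|supp v :|: supp w|)%N.
  move=> cv cw /set0Pn[k]; rewrite in_setI => /andP[kv kw].
  move=> /subsetPn[a av aw] /subsetPn[b bw bv].
  have [dv v0 vS _] := cv; have [dw w0 wS _] := cw.
  apply: (@card_elimination _ _ A S _ v w k a b) => //.
  - by rewrite subUset vS.
  - exact: dependencyS (subsetUl _ _) dv.
  - exact: dependencyS (subsetUr _ _) dw.
  - by move: kv; rewrite inE.
  - by move: kw; rewrite inE.
  - by move: av; rewrite inE.
  - exact: eq0.
  - exact: eq0.
  - by move: bw; rewrite inE.
have [v cv vmin] : exists2 v, circuit v &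
    forall w, circuit w -> (#|supp v| <= #|supp w|)%N.
  pose P m := `[< exists2 v, circuit v & #|supp v| = m >].
  have exP : exists m, P m.
    have [T TS cT] := @exists_subset_card _ S 5 (ltnW (ltnW S7)).
    have [v cv _] := circuit_in T TS cT.
    by exists #|supp v|; apply/asboolP; exists v.
  case: (ex_minnP exP) => m /asboolP[v cv <-] mmin; exists v => // w cw.
  by apply: mmin; apply/asboolP; exists w.
(* O is the set of vectors from outside that replace a; the elimination bound
   forbids w to meet u, their union having at most 6 elements. *)
have disj u a (O : {set V}) w : circuit u ->
    (forall w, circuit w -> (#|supp u| <= #|supp w|)%N) -> a \in supp u ->
    a \notin O -> (#|supp u| + #|O| <= 6)%N -> circuit w ->
    supp w \subset (supp u :\ a) :|: O -> supp u :&: supp w = set0.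
  move=> cu umin au aO cO cw wT; apply/eqP/negPn/negP => meet.
  have aw : a \notin supp w.
    by apply: contra aO => /(subsetP wT); rewrite in_setU setD11.
  have wu : ~~ (supp w \subset supp u).
    apply/negP => wu; have := umin w cw; rewrite leqNgt => /negP; apply.
    rewrite [ltnRHS](cardsD1 a) au ltnS subset_leq_card //.
    by apply/subsetP => i iw; rewrite in_setD1 (subsetP wu) // andbT;
      apply: contraNneq aw => <-.
  have uw : ~~ (supp u \subset supp w) by apply/subsetPn; exists a.
  have := union u w cu cw meet uw wu; rewrite leqNgt => /negP; apply.
  have cU : (#|supp u :|: O| <= 6)%N by rewrite (leq_trans (leq_card_setU _ _)).
  rewrite ltnS (leq_trans _ cU) // subset_leq_card //.
  rewrite subUset subsetUl (subset_trans wT) // setSU // subD1set //.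
have [_ _ vS v0] := cv.
have vD : (#|S| = #|supp v| + #|S :\: supp v|)%N.
  by rewrite -(cardsID (supp v) S) (setIidPr vS).
have v3 := circuit3 v cv.
have v5 : (#|supp v| <= 5)%N.
  have [T TS cT] := @exists_subset_card _ S 5 (ltnW (ltnW S7)).
  have [w cw wT] := circuit_in T TS cT.
  by rewrite -cT (leq_trans (vmin w cw)) // subset_leq_card.
have [O OD cO] : exists2 O : {set V}, O \subset S :\: supp v &
    #|O| = (6 - #|supp v|)%N.
  by apply: exists_subset_card; clear -vD S7 v3; lia.
have [OS Ov] := subsetDP OD.
have [a av] : exists a, a \in supp v by apply/card_gt0P.
have aO : a \notin O.
  by apply/negP => /(subsetP OD); rewrite in_setD av.
have cDU u b (P : {set V}) : b \in supp u -> [disjoint supp u & P] ->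
    #|(supp u :\ b) :|: P| = (#|supp u| + #|P|).-1.
  move=> bu uP; rewrite cardsU [_ :&: P]disjoint_setI0 ?cards0 ?subn0.
    by rewrite [#|supp u|](cardsD1 b) bu.
  by apply: disjointWl uP; apply: subD1set.
have vOS : (supp v :\ a) :|: O \subset S.
  by rewrite subUset OS (subset_trans (subD1set _ _) vS).
have [|w cw wT] := circuit_in _ vOS.
  by rewrite cDU // 1?disjoint_sym // cO; clear -v3 v5; lia.
have vw : supp v :&: supp w = set0 by apply: (disj v a O); rewrite // cO; clear -v5; lia.
have wO : supp w \subset O.
  apply/subsetP => i iw; have := subsetP wT i iw; rewrite in_setU in_setD1.
  case/orP => // /andP[_ iv]; have := in_set0 i.
  by rewrite -vw in_setI iv iw.
have w3 := circuit3 w cw.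
have cwO := subset_leq_card wO.
have eqO : supp w = O by apply/eqP; rewrite eqEcard wO cO; clear -v3 w3; lia.
have cv3 : #|supp v| = 3 by clear -v3 w3 cwO cO; lia.
have [e eS eN] : exists2 e, e \in S & e \notin supp v :|: O.
  apply/subsetPn/negP => /subset_leq_card.
  rewrite leqNgt => /negP; apply.
  by rewrite (leq_ltn_trans (leq_card_setU _ _)) // cv3 cO cv3.
have [ev eO] : e \notin supp v /\ e \notin O.
  by move: eN; rewrite in_setU negb_or => /andP[].
have [o oO] : exists o, o \in O by apply/card_gt0P; rewrite cO cv3.
have cOo : #|O :\ o| = 2 by have := cardsD1 o O; rewrite oO cO cv3; clear; lia.
have cva : #|supp v :\ a| = 2 by have := cardsD1 a (supp v); rewrite av cv3; clear; lia.
have ov : o \notin supp v by apply: contraTN oO => /(disjointFl Ov) ->.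
have cOe : #|e |: (O :\ o)| = 3.
  by rewrite cardsU1 in_setD1 (negPf eO) andbF cOo.
have cve : #|e |: (supp v :\ a)| = 3.
  by rewrite cardsU1 in_setD1 (negPf ev) andbF cva.
(* The two disjoint circuits are supp v and O = supp w; e is a seventh vector. *)
have TS : (supp v :\ a) :|: (e |: (O :\ o)) \subset S.
  rewrite !subUset sub1set eS (subset_trans (subD1set _ _) vS).
  by rewrite (subset_trans (subD1set _ _) OS).
have [|x cx xT] := circuit_in _ TS.
  rewrite cDU ?cOe ?cv3 // disjoint_subset; apply/subsetP => i iv.
  rewrite inE in_setU1 in_setD1 (disjointFl Ov iv) andbF orbF.
  by apply: contraNneq ev => <-.
have vx : supp v :&: supp x = set0.
  apply: (disj v a (e |: (O :\ o))) => //; last by rewrite cv3 cOe.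
  rewrite in_setU1 in_setD1 (negPf aO) andbF orbF.
  by apply: contraNneq ev => <-.
have wx : supp w :&: supp x = set0.
  apply: (disj w o (e |: (supp v :\ a))) => //.
  - by move=> y cy; rewrite eqO cO cv3 circuit3.
  - by rewrite eqO.
  - rewrite in_setU1 in_setD1 (negPf ov) andbF orbF.
    by apply: contraNneq eO => <-.
  - by rewrite eqO cO cve cv3.
  - by rewrite eqO setUCA (setUC (O :\ o)) setUCA.
have xe : supp x \subset [set e].
  apply/subsetP => i ix; have := subsetP xT i ix.
  rewrite !in_setU !in_setD1 in_set1 => /or3P[/andP[_ iv]|//|/andP[_ iO]].
    by have := in_set0 i; rewrite -vx in_setI iv ix.
  by have := in_set0 i; rewrite -wx in_setI ix eqO iO.
by have := leq_trans (circuit3 x cx) (subset_leq_card xe); rewrite cards1.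
Qed.

(** Without opposite pairs the bound 2r is not attained, except for r = 0. *)
Lemma card_opp_free (R : realFieldType) (V : finType) (A : V -> V -> R)
    (S : {set V}) (r : nat) :
  obtuse_system A S -> opp_free A S -> rank_le A S r -> (r <= 4)%N ->
  (#|S| < r.*2)%N \/ r = 0%N /\ S = set0.
Proof.
move=> sA freeA corA; case: r corA => [|[|[|[|[|//]]]]] corA _.
- right; split=> //; have [//|[i iS]] := set_0Vmem S.
  have [|||v [dv v0 [j vj]]] := @nonneg_dependency _ _ A S [set i] 0 sA freeA corA;
    rewrite ?sub1set ?cards1 //.
  have jS : j \in [set i] by apply: (dependency_in dv); rewrite gt_eqF.
  have dS : dependency A S S v by apply: dependencyS dv; rewrite sub1set.
  have := card_pos_dependency sA freeA dS vj.
  suff : (#|[set i | (0 < v i)%R]| <= #|[set i]|)%N by rewrite cards1; lia.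
  apply/subset_leq_card/subsetP => k; rewrite inE => vk.
  by apply: (dependency_in dv); rewrite gt_eqF.
- left; rewrite ltnNge; apply/negP => S2.
  have [T TS cT] := exists_subset_card S2.
  have [||v [dv v0 [j vj]]] := nonneg_dependency sA freeA corA TS; rewrite ?cT //.
  have := card_pos_dependency sA freeA (dependencyS TS dv) vj.
  suff : (#|[set i | (0 < v i)%R]| <= #|T|)%N by rewrite cT; lia.
  apply/subset_leq_card/subsetP => k; rewrite inE => vk.
  by apply: (dependency_in dv); rewrite gt_eqF.
- by left; have := card_opp_free_le3 sA freeA corA; lia.
- by left; have := card_opp_free_le3 sA freeA corA; lia.
- by left; have := card_opp_free4 sA freeA corA; lia.
Qed.

Lemma obtuse_orthogonal (R : realFieldType) (V : finType) (A : V -> V -> R)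
    (S : {set V}) (i j k : V) :
  obtuse_system A S -> i \in S -> j \in S -> k \in S ->
  A i j = -1 -> k != i -> k != j -> A i k = 0.
Proof.
move=> sA iS jS kS Aij ki kj; apply/eqP.
rewrite eq_le (obtuse_le0 sA) 1?eq_sym //= -oppr_le0.
by rewrite -(obtuse_opp sA iS jS Aij kS) (obtuse_le0 sA) 1?eq_sym.
Qed.

(** By [obtuse_orthogonal] the functional of i vanishes on all directions but
    those of i and j.  So a dependency supported on T and i has coefficient 0 at
    i, and is one on T alone. *)
Lemma rank_opp (R : realFieldType) (V : finType) (A : V -> V -> R)
    (S : {set V}) (r : nat) (i j : V) :
  obtuse_system A S -> rank_le A S r -> i \in S -> j \in S -> A i j = -1 ->
  (0 < r)%N /\ rank_le A (S :\ i :\ j) r.-1.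
Proof.
move=> sA corA iS jS Aij.
have r0 : (0 < r)%N.
  rewrite lt0n; apply/eqP => r0; rewrite r0 in corA.
  have [||v dv [k vk]] := corA [set i]; rewrite ?sub1set ?cards1 //.
  have ki : k = i by apply/set1P; apply: (dependency_in dv).
  move: vk; rewrite ki => /eqP; apply.
  rewrite -(dv.2 i iS) (bigD1 i) //= (obtuse_diag sA) // mul1r big1 ?addr0 //.
  by move=> l li; rewrite dv.1 ?mulr0 // inE.
split=> // T TS rT.
have /subsetP TS' := TS.
have iT : i \notin T.
  by apply/negP => /TS'; rewrite !in_setD1 eqxx andbF.
have iTS : i |: T \subset S.
  rewrite subUset sub1set iS; apply/subsetP => k /TS'.
  by rewrite !in_setD1 => /and3P[].
have [|v dv v0] := corA _ iTS; first by rewrite cardsU1 iT; lia.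
exists v => //.
have vi : v i = 0.
  rewrite -(dv.2 i iS) (bigD1 i) //= (obtuse_diag sA) // mul1r big1 ?addr0 //.
  move=> k ki; have [kT|kT] := boolP (k \in T); last first.
    by rewrite dv.1 ?mulr0 // in_setU1 negb_or ki.
  move: (TS' k kT); rewrite !in_setD1 => /and3P[kj _ kS].
  by rewrite (obtuse_orthogonal sA iS jS kS Aij) ?mul0r.
split=> [k kT|k]; last by rewrite !in_setD1 => /and3P[_ _ /(dv.2 k)].
have [->//|ki] := eqVneq k i.
by rewrite dv.1 // in_setU1 negb_or ki.
Qed.

(** Induction on the rank: by [card_opp_free] a system of size at least 2r > 0
    has an opposite pair, and removing it lowers the rank by one. *)
Lemma obtuse_cross_polytope (R : realFieldType) (V : finType)
    (A : V -> V -> R) (S : {set V}) (r : nat) :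
  obtuse_system A S -> rank_le A S r -> (r <= 4)%N ->
  (#|S| <= r.*2)%N /\
  (#|S| = r.*2 ->
   (forall i, i \in S -> exists2 j, j \in S & A i j = -1) /\
   exists H : {set V}, [/\ H \subset S, #|H| = r &
     forall h g, h \in H -> g \in H -> h != g -> A h g = 0]).
Proof.
elim/ltn_ind: r S => r IHr S sA corA r4.
have [[i [j [iS jS Aij]]]|noopp] :=
    pselect (exists i j, [/\ i \in S, j \in S & A i j = -1]); last first.
  have freeA : opp_free A S.
    by move=> i j iS jS; apply/eqP => Aij; apply: noopp; exists i, j.
  case: (card_opp_free sA freeA corA r4) => [Sr|[-> ->]]; first by split; lia.
  rewrite cards0; split=> // _; split=> [i|]; first by rewrite inE.
  by exists set0; rewrite cards0; split=> // h g; rewrite inE.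
have [r0 corA'] := rank_opp sA corA iS jS Aij.
have S'S : S :\ i :\ j \subset S.
  exact: subset_trans (subD1set _ _) (subD1set _ _).
have sA' : obtuse_system A (S :\ i :\ j).
  case: sA => d le0 geN1 opp; have /subsetP sub := S'S.
  split=> [k /sub/d //|k l /sub kS /sub lS|k l /sub kS /sub lS|].
  - exact: le0.
  - exact: geN1.
  - move=> k l /sub kS /sub lS Akl m /sub mS; exact: opp.
have ji : j != i.
  by apply/eqP => ji; move: Aij; rewrite ji (obtuse_diag sA) //; lra.
have cS : #|S| = #|S :\ i :\ j|.+2.
  by rewrite (cardsD1 i) iS (cardsD1 j (S :\ i)) in_setD1 ji jS.
have [||S'r frame] := IHr r.-1 _ (S :\ i :\ j) sA' corA'; [lia|lia|].
split=> [|Sr]; first by lia.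
have [|inv [H [HS cH orth]]] := frame; first by lia.
have Aji : A j i = -1 by rewrite (obtuse_opp sA iS jS Aij) // (obtuse_diag sA).
split=> [k kS|].
  have [->|ki] := eqVneq k i; first by exists j.
  have [->|kj] := eqVneq k j; first by exists i.
  have [|l lS' Akl] := inv k; first by rewrite !in_setD1 kj ki.
  by exists l => //; apply: (subsetP S'S).
have HP h : h \in H -> [/\ h != i, h != j & h \in S].
  by move=> /(subsetP HS); rewrite !in_setD1 => /and3P[].
exists (i |: H); split.
- by rewrite subUset sub1set iS (subset_trans HS).
- rewrite cardsU1; case: (boolP (i \in H)) => [/HP[]|_]; first by rewrite eqxx.
  by rewrite cH; lia.
- move=> h g; rewrite !in_setU1.
  move=> /orP[/eqP->|hH] /orP[/eqP->|gH] hg; last exact: orth.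
  + by rewrite eqxx in hg.
  + by have [gi gj gS] := HP g gH; apply: (obtuse_orthogonal sA iS jS).
  + have [hi hj hS] := HP h hH.
    have [l lS' Ahl] := inv h (subsetP HS h hH).
    have lS := subsetP S'S l lS'.
    apply: (obtuse_orthogonal sA hS lS iS Ahl); first by rewrite eq_sym.
    by apply: contraTneq lS' => <-; rewrite !in_setD1 eqxx andbF.
Qed.

(** * An isoperimetric inequality for extremal points *)

(** An inequality between sums may be checked on the fibers of any map; it is
    used for slices and for parallel classes, whose indices are not finite
    types. *)
Lemma ler_sum_fibers (R : numDomainType) (V : finType) (T : eqType)
    (h : V -> T) (F : {set V}) (a b : V -> R) :
  (forall u, u \in F -> \sum_(v in F | h v == h u) b v
                        <= \sum_(v in F | h v == h u) a v) ->
  \sum_(v in F) b v <= \sum_(v in F) a v.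
Proof.
move=> ab; pose rep v := odflt v [pick u in F | h u == h v].
have repE u v : u \in F -> v \in F -> (rep v == rep u) = (h v == h u).
  have hrep w : w \in F -> h (rep w) = h w.
    rewrite /rep => wF; case: pickP => [z /andP[_ /eqP]//|/(_ w)].
    by rewrite /= wF eqxx.
  move=> uF vF; apply/eqP/eqP => [e|e]; first by rewrite -hrep // e hrep.
  rewrite /rep e; case: pickP => // /(_ u); by rewrite /= uF eqxx.
rewrite (partition_big rep xpredT) //= [leRHS](partition_big rep xpredT) //=.
apply: ler_sum => j _.
have [[u uF <-]|noj] := pselect (exists2 u, u \in F & rep u = j).
  have := ab u uF; congr (_ <= _); apply: eq_bigl => v;
    by case: (boolP (v \in F)) => // vF; rewrite repE.
rewrite !big1 // => v /andP[vF /eqP repv]; case: noj; by exists v.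
Qed.

(** The line through v parallel to the i-th axis, when only the coordinates in J
    are taken into account. *)
Definition same_line (R : realType) (V I : finType) (phi : V -> I -> R)
    (J : {set I}) (i : I) (v w : V) : bool :=
  [forall j in J, (j != i) ==> (phi v j == phi w j)].

Definition topmost (R : realType) (V I : finType) (phi : V -> I -> R)
    (J : {set I}) (F : {set V}) (i : I) (v : V) : bool :=
  [forall w in F, same_line phi J i v w ==> (phi w i <= phi v i)].

Lemma same_lineP (R : realType) (V I : finType) (phi : V -> I -> R)
    (J : {set I}) (i : I) (v w : V) :
  reflect (forall j, j \in J -> j != i -> phi v j = phi w j)
          (same_line phi J i v w).
Proof.
apply: (iffP forall_inP) => H j jJ; first by move=> ji; apply/eqP/(implyP (H j jJ)).
by apply/implyP => ji; apply/eqP/H.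
Qed.

Lemma topmostP (R : realType) (V I : finType) (phi : V -> I -> R)
    (J : {set I}) (F : {set V}) (i : I) (v : V) :
  reflect (forall w, w \in F -> same_line phi J i v w -> phi w i <= phi v i)
          (topmost phi J F i v).
Proof. by apply: (iffP forall_inP) => H w wF; apply/implyP/H. Qed.

Definition coordinates_on (R : realType) (V I : finType) (phi : V -> I -> R)
    (J : {set I}) (F : {set V}) : Prop :=
  forall v w, v \in F -> w \in F -> (forall j, j \in J -> phi v j = phi w j) ->
  v = w.

(** Moving a point of the slice to the top of its line in the direction j is
    injective, as the lines of distinct points of the slice are distinct. *)
Lemma card_slice_le_tops (R : realType) (V I : finType) (phi : V -> I -> R)
    (J : {set I}) (F : {set V}) (j : I) (u : V) :
  coordinates_on phi J F ->
  (#|[set v in F | phi v j == phi u j]|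
   <= #|[set v in F | topmost phi J F j v]|)%N.
Proof.
move=> inj.
pose top v := [arg max_(w > v | (w \in F) && same_line phi J j v w) phi w j]%O.
have refl v : same_line phi J j v v by apply/same_lineP.
have topP v : v \in F -> [/\ top v \in F, same_line phi J j v (top v)
   & forall w, w \in F -> same_line phi J j v w -> phi w j <= phi (top v) j].
  move=> vF; rewrite /top; case: Order.TotalTheory.arg_maxP => [|w /andP[wF vw] wmax].
    by rewrite vF refl.
  by split=> // x xF vx; apply: wmax; rewrite xF.
rewrite -(@card_in_imset _ _ top [set v in F | phi v j == phi u j]).
  apply/subset_leq_card/subsetP => x /imsetP[v]; rewrite inE => /andP[vF _] ->.
  have [tF vt tmax] := topP v vF.
  rewrite inE tF; apply/topmostP => w wF tw; apply: tmax => //.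
  apply/same_lineP => i iJ ij.
  by rewrite (same_lineP _ _ _ _ _ vt) // (same_lineP _ _ _ _ _ tw).
move=> v w; rewrite !inE => /andP[vF /eqP vu] /andP[wF /eqP wu] e.
apply: inj => // i iJ; have [->|ij] := eqVneq i j; first by rewrite vu wu.
have [_ /same_lineP vt _] := topP v vF; have [_ /same_lineP wt _] := topP w wF.
by rewrite vt // wt // e.
Qed.

(** Since M = M^(k/(k+1)) M^(1/(k+1)).  This form of concavity lets the bounds
    for pieces of size M be summed up: each element of each piece carries the
    same weight N^(-1/(k+1)). *)
Lemma powR_self_bound (R : realType) (M N : R) (k : nat) :
  0 < M -> M <= N -> M * N `^ (- k.+1%:R^-1) <= M `^ (k%:R / k.+1%:R).
Proof.
move=> M0 MN; have N0 : 0 < N by apply: lt_le_trans MN.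
have k1 : (k.+1%:R : R) != 0 by rewrite pnatr_eq0.
rewrite powRN ler_pdivrMr ?powR_gt0 //.
apply: (@le_trans _ _ (M `^ (k%:R / k.+1%:R) * M `^ k.+1%:R^-1)).
  rewrite -powRD ?(lt0r_neq0 M0) ?implybT // -{2}[k.+1%:R^-1]mul1r -mulrDl natr1.
  by rewrite divff // powRr1 // ltW.
rewrite ler_wpM2l ?powR_ge0 // ge0_ler_powR ?invr_ge0 ?ler0n ?nnegrE //; exact: ltW.
Qed.

Lemma powR_card_sum (R : realType) (V : finType) (F : {set V}) (k : nat) :
  (0 < #|F|)%N ->
  #|F|%:R `^ (k%:R / k.+1%:R) = \sum_(v in F) #|F|%:R `^ (- k.+1%:R^-1) :> R.
Proof.
move=> F0; have N0 : 0 < #|F|%:R :> R by rewrite ltr0n.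
rewrite sumr_const -[RHS]mulr_natl -{2}[#|F|%:R]powRr1 ?ltW //.
rewrite -powRD; last by rewrite (lt0r_neq0 N0) implybT.
congr (_ `^ _); have k1 : (k.+1%:R : R) != 0 by rewrite pnatr_eq0.
by apply: (mulIf k1); rewrite divfK // mulrBl mul1r mulVf // -[k.+1%:R]natr1 addrK.
Qed.

Lemma card_slice_le_sum (R : realType) (V I : finType) (phi : V -> I -> R)
    (J : {set I}) (F : {set V}) (j : I) (u : V) :
  j \in J -> coordinates_on phi J F ->
  (#|[set v in F | phi v j == phi u j]|
   <= \sum_(v in F) #|[set i in J | topmost phi J F i v]|)%N.
Proof.
move=> jJ inj; apply: leq_trans (card_slice_le_tops j u inj) _.
rewrite -sum1_card (eq_bigl (fun v => (v \in F) && topmost phi J F j v)) => [|v];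
  last by rewrite inE.
rewrite big_mkcondr /=; apply: leq_sum => v vF; case: ifP => // jv.
by apply/card_gt0P; exists j; rewrite inE jJ.
Qed.

(** A discrete substitute for the Loomis-Whitney inequality, by induction on the
    dimension.  Slice F orthogonally to one axis j.  A slice with at least
    |F|^(k/(k+1)) points yields enough tops in the direction j alone.  If all
    slices are smaller, the tops in the other directions can be counted slice
    by slice, and small slices have a large relative boundary. *)
Lemma tops_isoperimetry (R : realType) (V I : finType) (phi : V -> I -> R)
    (k : nat) (J : {set I}) (F : {set V}) :
  #|J| = k.+1 -> F != set0 -> coordinates_on phi J F ->
  #|F|%:R `^ (k%:R / k.+1%:R)
    <= (\sum_(v in F) #|[set i in J | topmost phi J F i v]|)%:R :> R.
Proof.
elim: k J F => [|k IHk] J F cJ F0 inj;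
  have /card_gt0P[j jJ] : (0 < #|J|)%N by rewrite cJ.
  have /set0Pn[u uF] := F0.
  rewrite mul0r powRr0 ler1n (leq_trans _ (card_slice_le_sum u jJ inj)) //.
  by apply/card_gt0P; exists u; rewrite inE uF eqxx.
pose N : R := #|F|%:R.
have cF : (0 < #|F|)%N by rewrite card_gt0.
have N0 : 0 < N by rewrite ltr0n.
pose slice u := [set v in F | phi v j == phi u j].
have [[u big]|small] :=
    pselect (exists u, N `^ (k.+1%:R / k.+2%:R) <= #|slice u|%:R).
  by rewrite (le_trans big) // ler_nat card_slice_le_sum.
have NE : N `^ (- k.+2%:R^-1) = (N `^ (k.+1%:R / k.+2%:R)) `^ (- k.+1%:R^-1).
  rewrite -powRrM; congr (_ `^ _).
  by rewrite mulrN mulrAC divff ?mul1r // pnatr_eq0.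
rewrite powR_card_sum //.
rewrite natr_sum; apply: (ler_sum_fibers (h := phi ^~ j)) => u uF /=.
have sliceE v : (v \in F) && (phi v j == phi u j) = (v \in slice u).
  by rewrite inE.
rewrite !(eq_bigl _ _ sliceE) sumr_const -[leLHS]mulr_natl.
have S0 : slice u != set0.
  by apply/set0Pn; exists u; rewrite inE uF eqxx.
have SF v : v \in slice u -> v \in F by rewrite inE => /andP[].
have cJj : #|J :\ j| = k.+1 by move: cJ; rewrite (cardsD1 j) jJ; lia.
have injS : coordinates_on phi (J :\ j) (slice u).
  move=> v w vS wS e; apply: inj; rewrite ?SF // => i iJ.
  have [->|ij] := eqVneq i j; last by rewrite e // in_setD1 ij.
  by move: vS wS; rewrite !inE => /andP[_ /eqP->] /andP[_ /eqP->].
rewrite -/N NE; apply: le_trans (powR_self_bound _ _ _) _.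
- by rewrite ltr0n card_gt0.
- by rewrite leNgt; apply/negP => /ltW lt; apply: small; exists u.
apply: le_trans (IHk _ _ cJj S0 injS) _; rewrite natr_sum; apply: ler_sum => v vS.
rewrite ler_nat subset_leq_card //; apply/subsetP => i.
rewrite !inE => /andP[/andP[ij iJ] /topmostP top]; rewrite iJ.
apply/topmostP => w wF /same_lineP vw.
apply: top; last first.
  by apply/same_lineP => l; rewrite in_setD1 => /andP[_ lJ] li; apply: vw.
by move: vS; rewrite !inE wF => /andP[_ /eqP<-] /=; rewrite (vw j) ?eqxx // eq_sym.
Qed.

(** * Unit functionals and the geometry of contacts *)

From mathcomp Require Import classical_sets functions interval_inference.
From mathcomp Require Import topology normedtype convex derive trigo.

Import numFieldNormedType.Exports.
Local Open Scope classical_set_scope.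

Lemma dotDr (R : realType) (d : nat) (u x y : 'rV[R]_d) :
  dot u (x + y) = dot u x + dot u y.
Proof. by rewrite -big_split; apply: eq_bigr => i _; rewrite mxE mulrDr. Qed.

Lemma dotZr (R : realType) (d : nat) (u x : 'rV[R]_d) (a : R) :
  dot u (a *: x) = a * dot u x.
Proof. by rewrite mulr_sumr; apply: eq_bigr => i _; rewrite mxE mulrCA. Qed.

Lemma dotNr (R : realType) (d : nat) (u x : 'rV[R]_d) : dot u (- x) = - dot u x.
Proof. by rewrite -scaleN1r dotZr mulN1r. Qed.

Lemma dotBr (R : realType) (d : nat) (u x y : 'rV[R]_d) :
  dot u (x - y) = dot u x - dot u y.
Proof. by rewrite dotDr dotNr. Qed.

Lemma dotr0 (R : realType) (d : nat) (u : 'rV[R]_d) : dot u 0 = 0.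
Proof. by rewrite -(subrr u) dotBr subrr. Qed.

Lemma dotC (R : realType) (d : nat) (u x : 'rV[R]_d) : dot u x = dot x u.
Proof. by apply: eq_bigr => i _; rewrite mulrC. Qed.

Lemma dotZl (R : realType) (d : nat) (u x : 'rV[R]_d) (a : R) :
  dot (a *: u) x = a * dot u x.
Proof. by rewrite dotC dotZr dotC. Qed.

Lemma dotNl (R : realType) (d : nat) (u x : 'rV[R]_d) : dot (- u) x = - dot u x.
Proof. by rewrite dotC dotNr dotC. Qed.

Lemma dotBl (R : realType) (d : nat) (u v x : 'rV[R]_d) :
  dot (u - v) x = dot u x - dot v x.
Proof. by rewrite !(dotC _ x) dotBr. Qed.

Lemma dot_self_gt0 (R : realType) (d : nat) (u : 'rV[R]_d) :
  u != 0 -> 0 < dot u u.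
Proof.
move=> u0; have [[i ui]|all0] := pselect (exists i, u ord0 i != 0).
  rewrite /dot (bigD1 i) //= ltr_wpDr //; last by rewrite -expr2 exprn_even_gt0.
  by apply: sumr_ge0 => j _; rewrite -expr2 sqr_ge0.
case/eqP: u0; apply/rowP => i; rewrite mxE; apply/eqP/negPn/negP => ui.
by apply: all0; exists i.
Qed.

Lemma dot_inj (R : realType) (d : nat) (u v : 'rV[R]_d) :
  (forall x, dot u x = dot v x) -> u = v.
Proof.
move=> uv; apply/eqP; rewrite -subr_eq0; apply/negPn/negP => /dot_self_gt0.
by rewrite dotBl uv subrr ltxx.
Qed.

Lemma dot_continuous (R : realType) (d : nat) (u : 'rV[R]_d) :
  continuous (dot u).
Proof.
rewrite /dot => x; elim: (index_enum _) => [|i s IHs].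
  have -> : (fun x : 'rV[R]_d => \sum_(i <- [::]) u ord0 i * x ord0 i) = cst 0.
    by apply/funext => y; rewrite big_nil.
  exact: cst_continuous.
have -> : (fun x : 'rV[R]_d => \sum_(j <- i :: s) u ord0 j * x ord0 j) =
    (fun x => u ord0 i * x ord0 i + \sum_(j <- s) u ord0 j * x ord0 j).
  by apply/funext => y; rewrite big_cons.
have cvgi : (fun y : 'rV[R]_d => u ord0 i * y ord0 i) @ x --> u ord0 i * x ord0 i.
  apply: (@cvgMl_tmp _ _ (nbhs x) (nbhs_filter x)); exact: coord_continuous.
exact: (@cvgD _ _ _ (nbhs x) (nbhs_filter x) _ _ _ _ cvgi IHs).
Qed.

(** The topology on row vectors is that of the supremum norm. *)
Lemma interiorP (R : realType) (d : nat) (K : set 'rV[R]_d) (x : 'rV[R]_d) :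
  K° x <-> exists2 e : R, 0 < e &
    forall y : 'rV[R]_d, (forall i, `|x ord0 i - y ord0 i| < e) -> K y.
Proof.
split=> [/nbhs_ballP[e /= e0 eK]|[e e0 eK]].
  exists e => // y xy; apply: eK; split=> // i j; rewrite [i]ord1; exact: xy.
apply/nbhs_ballP; exists e => //= y [_ xy]; apply: eK => i; exact: xy.
Qed.

Lemma o_symmetricN (R : realType) (d : nat) (K : set 'rV[R]_d) (x : 'rV[R]_d) :
  o_symmetric K -> K x -> K (- x).
Proof. by move=> KN Kx; rewrite KN; exists x. Qed.

Lemma convex_comb (R : realType) (d : nat) (K : set 'rV[R]_d) (x y : 'rV[R]_d)
    (t : R) :
  convex_body K -> K x -> K y -> 0 <= t <= 1 -> K (t *: x + (1 - t) *: y).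
Proof.
move=> [_ cK _] Kx Ky /andP[t0 t1].
by have := cK x y (Itv01 t0 t1); rewrite !inE; apply.
Qed.

(** The origin is the midpoint of an interior point a and of -a. *)
Lemma ball_at_origin (R : realType) (d : nat) (K : set 'rV[R]_d) :
  convex_body K -> o_symmetric K ->
  exists2 e : R, 0 < e & forall y : 'rV[R]_d, (forall i, `|y ord0 i| < e) -> K y.
Proof.
move=> bK sK; have [_ _ [a /interiorP[e e0 eK]]] := bK.
have Ka : K a by apply: eK => i; rewrite subrr normr0.
exists (e / 2) => [|y ye]; first by rewrite divr_gt0.
have -> : y = 2^-1 *: (a + 2 *: y) + (1 - 2^-1) *: (- a).
  by apply/rowP => i; rewrite !mxE; field.
apply: convex_comb => //; last 1 first; try lra.
- apply: eK => i; rewrite !mxE opprD addrA subrr add0r normrN normrM.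
  by rewrite normr_nat mulrC -ltr_pdivlMr.
- exact: o_symmetricN.
Qed.

Lemma interior_translate (R : realType) (d : nat) (K : set 'rV[R]_d)
    (c k : 'rV[R]_d) (t : R) :
  convex_body K -> o_symmetric K -> K k -> 0 <= t < 1 ->
  (translate K c)° (c + t *: k).
Proof.
move=> bK sK Kk /andP[t0 t1]; have [e e0 eK] := ball_at_origin bK sK.
have t1' : 0 < 1 - t by lra.
apply/interiorP; exists ((1 - t) * e) => [|y ye]; first by rewrite mulr_gt0.
exists (y - c); last by rewrite addrC subrK.
have -> : y - c = t *: k + (1 - t) *: ((1 - t)^-1 *: (y - c - t *: k)).
  by rewrite scalerA divff ?gt_eqF // scale1r [RHS]addrC subrK.
apply: convex_comb => //; last by apply/andP; split; lra.
apply: eK => i; have := ye i; rewrite distrC !mxE normrM gtr0_norm ?invr_gt0 //.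
by rewrite ltr_pdivrMl // opprD addrA.
Qed.

(** The functionals of dual norm one for the norm with unit ball K. *)
Definition unit_functional (R : realType) (d : nat) (K : set 'rV[R]_d)
    (f : 'rV[R]_d) : Prop :=
  (forall x, K x -> dot f x <= 1) /\ exists2 x, K x & dot f x = 1.

Lemma unit_functional_scale (R : realType) (d : nat) (K : set 'rV[R]_d)
    (u : 'rV[R]_d) :
  convex_body K -> o_symmetric K -> u != 0 ->
  exists2 s : R, 0 < s & unit_functional K (s *: u).
Proof.
move=> bK sK u0; have [cK _ [a /interior_subset Ka]] := bK.
have [||x + xmax] := @compact_EVT_max _ R (dot u) K _ cK.
- by exists a.
- exact/continuous_subspaceT/dot_continuous.
rewrite inE => Kx; have [e e0 eK] := ball_at_origin bK sK.
have ux : 0 < dot u x.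
  pose M := \sum_i `|u ord0 i|.
  have M0 : 0 <= M by apply: sumr_ge0.
  have Ks : K ((e / (M + 1)) *: u).
    apply: eK => i; rewrite mxE normrM ger0_norm ?divr_ge0 // ?ltW ?ltr_wpDl //.
    rewrite mulrAC ltr_pdivrMr ?ltr_wpDl // ltr_pM2l //.
    rewrite /M (bigD1 i) //= -addrA ltrDl ltr_wpDl // sumr_ge0 //.
  apply: lt_le_trans (xmax _ (mem_set Ks)).
  by rewrite dotZr mulr_gt0 ?dot_self_gt0 // divr_gt0 // ltr_wpDl.
exists (dot u x)^-1; first by rewrite invr_gt0.
split=> [y Ky|]; last by exists x => //; rewrite dotZl mulVf // gt_eqF.
by rewrite dotZl mulrC ler_pdivrMr // mul1r xmax // inE.
Qed.

Lemma unit_functional_geN1 (R : realType) (d : nat) (K : set 'rV[R]_d)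
    (f x : 'rV[R]_d) :
  o_symmetric K -> unit_functional K f -> K x -> -1 <= dot f x.
Proof.
by move=> sK [f1 _] /(o_symmetricN sK)/f1; rewrite dotNr lerNl.
Qed.

Lemma unit_functionalN (R : realType) (d : nat) (K : set 'rV[R]_d)
    (f : 'rV[R]_d) :
  o_symmetric K -> unit_functional K f -> unit_functional K (- f).
Proof.
move=> sK uf; have [f1 [x Kx fx]] := uf; split=> [y Ky|].
  by rewrite dotNl lerNl; apply: unit_functional_geN1 uf Ky.
by exists (- x); [exact: o_symmetricN|rewrite dotNl dotNr opprK].
Qed.

Lemma unit_functional_boundary (R : realType) (d : nat) (K : set 'rV[R]_d)
    (f x : 'rV[R]_d) :
  unit_functional K f -> K x -> dot f x = 1 -> (closure K `\` K°) x.
Proof.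
move=> [f1 _] Kx fx; split; first exact: subset_closure.
move=> /interiorP[e e0 eK].
pose M := \sum_i `|x ord0 i|.
have M0 : 0 <= M by apply: sumr_ge0.
have /f1 : K ((1 + e / (M + 1)) *: x).
  apply: eK => i; rewrite mxE mulrDl mul1r opprD addrA subrr add0r normrN normrM.
  rewrite ger0_norm ?divr_ge0 // ?ltW ?ltr_wpDl //.
  rewrite mulrAC ltr_pdivrMr ?ltr_wpDl // ltr_pM2l //.
  by rewrite /M (bigD1 i) //= -addrA ltrDl ltr_wpDl // sumr_ge0.
rewrite dotZr fx mulr1 gerDl leNgt => /negP; apply.
by rewrite divr_gt0 // ltr_wpDl.
Qed.

(** Both functionals define supporting hyperplanes at x, which coincide by
    smoothness; a functional is determined by its level set at 1. *)
Lemma smooth_unit_functional (R : realType) (d : nat) (K : set 'rV[R]_d)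
    (f g x : 'rV[R]_d) :
  smooth K -> unit_functional K f -> unit_functional K g -> K x ->
  dot f x = 1 -> dot g x = 1 -> f = g.
Proof.
move=> smK uf ug Kx fx gx.
have sup h : unit_functional K h -> dot h x = 1 ->
    supporting_hyperplane K x (hyperplane h 1).
  move=> [h1 _] hx; exists h, 1; split=> //.
  by apply/eqP => h0; move: hx; rewrite h0 -(scale0r 0) dotZl mul0r; lra.
have [H [_ Huniq]] := smK x (unit_functional_boundary uf Kx fx).
have fg : hyperplane f 1 = hyperplane g 1.
  by rewrite -(Huniq _ (sup f uf fx)) -(Huniq _ (sup g ug gx)).
have ker y : dot f y = 0 -> dot g y = 0.
  move=> fy; have : hyperplane f 1 (x + y) by rewrite /hyperplane /= dotDr fx fy addr0.
  by rewrite fg /hyperplane /= dotDr gx; lra.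
apply: dot_inj => y; have := ker (y - dot f y *: x).
rewrite !dotBr !dotZr fx gx mulr1 subrr => /(_ erefl) /eqP.
by rewrite subr_eq0 => /eqP.
Qed.

(** After normalization every member has width 2 in the direction of the
    functional, so a hyperplane that avoids the interiors stays at distance at
    least 1 from all centres. *)
Lemma separating_unit_functional (R : realType) (d n : nat) (K : set 'rV[R]_d)
    (c : 'I_n -> 'rV[R]_d) (i j : 'I_n) :
  convex_body K -> o_symmetric K -> totally_separable K c -> i != j ->
  exists f a, [/\ unit_functional K f, dot f (c i) + 1 <= a,
    a <= dot f (c j) - 1 &
    forall k, dot f (c k) <= a - 1 \/ a + 1 <= dot f (c k)].
Proof.
move=> bK sK sepc ij; have [u [a [u0 [ui uj] miss]]] := sepc i j ij.
have [s s0 uf] := unit_functional_scale bK sK u0.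
have [f1 [x Kx fx]] := uf.
have in_tr k y : K y -> translate K (c k) (c k + y) by exists y.
exists (s *: u), (s * a); split=> //.
- by rewrite -fx -dotDr dotZl ler_pM2l //; apply/ui/in_tr.
- rewrite -fx -dotBr dotZl ler_pM2l //; apply/uj/in_tr; exact: o_symmetricN.
move=> k; have [lt|] := ltP (`|s * a - dot (s *: u) (c k)|) 1; last first.
  by rewrite ler_normr => /orP[]; [left|right]; lra.
(* Otherwise the hyperplane passes through a contracted point of the member. *)
have hit y t : K y -> 0 <= t < 1 -> dot (s *: u) (c k + t *: y) = s * a -> False.
  move=> Ky t01; rewrite dotZl => /(mulfI (lt0r_neq0 s0)) ha.
  have : set0 (c k + t *: y); last by [].
  by rewrite -(miss k); split => //; apply: interior_translate.
move: lt; rewrite ltr_norml => /andP[lo hi].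
have [t0|t0] := leP 0 (s * a - dot (s *: u) (c k)).
  case: (hit x (s * a - dot (s *: u) (c k))) => //; first by rewrite t0.
  by rewrite dotDr dotZr fx; ring.
case: (hit (- x) (dot (s *: u) (c k) - s * a)); first exact: o_symmetricN.
  by apply/andP; split; lra.
by rewrite dotDr dotZr dotNr fx; ring.
Qed.

(** For touching members this is the contact point relative to the centre of the
    first one, a boundary point of K; the factor 1/2 makes it a unit vector. *)
Definition direction (R : realType) (d n : nat) (c : 'I_n -> 'rV[R]_d)
    (i j : 'I_n) : 'rV[R]_d := 2^-1 *: (c j - c i).

Lemma directionN (R : realType) (d n : nat) (c : 'I_n -> 'rV[R]_d)
    (i j : 'I_n) : direction c i j = - direction c j i.
Proof. by rewrite /direction -scalerN opprB. Qed.

Lemma direction_add (R : realType) (d n : nat) (c : 'I_n -> 'rV[R]_d)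
    (i j k : 'I_n) : direction c i k = direction c i j + direction c j k.
Proof. by rewrite /direction -scalerDr [X in _ = _ *: X]addrC subrKA. Qed.

(** What the rest of the proof uses of a packing: [f i j] is the unit functional
    of the hyperplane that separates the touching members i and j.  The
    hyperplane may not cut a third member ([cf_gap]), and smoothness makes it
    determined by the direction of the contact ([cf_uniq], [cf_sym]). *)
Record contact_system (R : realType) (d n : nat) (c : 'I_n -> 'rV[R]_d)
    (adj : rel 'I_n) (f : 'I_n -> 'I_n -> 'rV[R]_d) : Prop := ContactSystem {
  adj_sym : symmetric adj;
  cf_diag : forall i j, adj i j -> dot (f i j) (direction c i j) = 1;
  cf_le1 : forall i j k l, adj i j -> adj k l ->
    dot (f i j) (direction c k l) <= 1;
  cf_gap : forall i j k, adj i j ->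
    dot (f i j) (direction c i k) <= 0 \/ 1 <= dot (f i j) (direction c i k);
  cf_uniq : forall i j k l, adj i j -> adj k l ->
    dot (f i j) (direction c k l) = 1 -> f k l = f i j;
  cf_sym : forall i j, adj i j -> f j i = - f i j;
  cf_le0 : forall i j k, adj i j -> adj i k -> j != k ->
    dot (f i j) (direction c i k) <= 0;
  cs_inj : injective c }.

Definition contact (R : realType) (d n : nat) (K : set 'rV[R]_d)
    (c : 'I_n -> 'rV[R]_d) : rel 'I_n :=
  fun i j => (i != j) && `[< touch K c i j >].

(** The sign condition [cf_le0] uses total separability twice.  By the gap it can
    only fail if the functional f of the contact of i and j is also 1 at the
    contact point of i and k.  A hyperplane separating j from k does not cut
    the member i, so its functional is 1 or -1 at one of the two contact
    points; by smoothness it is f or -f, but f has the same value at the centres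
    of j and k. *)
Lemma contact_system_exists (R : realType) (d n : nat) (K : set 'rV[R]_d)
    (c : 'I_n -> 'rV[R]_d) :
  convex_body K -> o_symmetric K -> smooth K -> totally_separable K c ->
  exists f, contact_system c (contact K c) f.
Proof.
move=> bK sK smK sepc.
have csym : symmetric (contact K c).
  move=> i j; rewrite /contact eq_sym; congr (_ && _).
  by apply/asboolP/asboolP; rewrite /touch setIC.
have dirK i j : contact K c i j -> K (direction c i j).
  move=> /andP[_ /asboolP[_ [[x Kx <-] [y Ky /esym xy]]]].
  have -> : direction c i j = 2^-1 *: x + (1 - 2^-1) *: (- y).
    have cj : c j = c i + x - y by rewrite xy addrK.
    by rewrite /direction cj; apply/rowP => k; rewrite !mxE; field.
  by apply: convex_comb => //; [exact: o_symmetricN|apply/andP; split; lra].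
have dotdir f i j : dot f (direction c i j) = (dot f (c j) - dot f (c i)) / 2.
  by rewrite dotZr dotBr mulrC.
have /choice[g gP] : forall e : 'I_n * 'I_n, exists g : 'rV[R]_d,
    contact K c e.1 e.2 -> [/\ unit_functional K g,
      dot g (direction c e.1 e.2) = 1 &
      forall k, dot g (direction c e.1 k) <= 0 \/
                1 <= dot g (direction c e.1 k)].
  move=> [i j] /=.
  have [ij|nij] := boolP (contact K c i j); last by exists 0.
  have [g [a [ug gi gj gap]]] := separating_unit_functional bK sK sepc (andP ij).1.
  have := ug.1 _ (dirK i j ij); rewrite dotdir => le1.
  by exists g => _; split=> // [|k]; rewrite dotdir; [lra|case: (gap k); lra].
pose f i j := g (i, j).
have fP i j : contact K c i j -> [/\ unit_functional K (f i j),
    dot (f i j) (direction c i j) = 1 &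
    forall k, dot (f i j) (direction c i k) <= 0 \/
              1 <= dot (f i j) (direction c i k)] by move=> ij; have := gP (i, j) ij.
exists f; split=> //.
- by move=> i j /fP[].
- by move=> i j k l /fP[[f1 _] _ _] /dirK/f1.
- by move=> i j k /fP[_ _].
- move=> i j k l ij kl e; have [uf _ _] := fP _ _ ij; have [ug gkl _] := fP _ _ kl.
  exact: smooth_unit_functional smK ug uf (dirK _ _ kl) gkl e.
- move=> i j ij; have ji : contact K c j i by rewrite csym.
  have [uf fij _] := fP _ _ ij; have [ug gji _] := fP _ _ ji.
  apply: smooth_unit_functional smK ug (unit_functionalN sK uf) (dirK _ _ ji) gji _.
  by rewrite directionN dotNr dotNl opprK.
- move=> i j k ij ik jk; have [uf fij gapf] := fP _ _ ij.
  have [//|ge1] := gapf k.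
  have fik : dot (f i j) (direction c i k) = 1.
    by apply/eqP; rewrite eq_le ge1 uf.1 //; apply: dirK.
  have [h [a [ug gj gk gap]]] := separating_unit_functional bK sK sepc jk.
  have := ug.1 _ (dirK _ _ ik); have := unit_functional_geN1 sK ug (dirK _ _ ij).
  rewrite !dotdir => lo hi.
  have [gi|gi] := gap i.
  + have gik : dot h (direction c i k) = 1 by rewrite dotdir; lra.
    have gf : h = f i j by apply: smooth_unit_functional smK ug uf (dirK _ _ ik) gik fik.
    by move: fij; rewrite -gf dotdir; lra.
  + have gij : dot (- h) (direction c i j) = 1 by rewrite dotNl dotdir; lra.
    have gf : - h = f i j.
      exact: smooth_unit_functional smK (unit_functionalN sK ug) uf (dirK _ _ ij) gij fij.
    by move: fik; rewrite -gf dotNl dotdir; lra.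
- move=> i j cij; apply/eqP/negPn/negP => ij.
  have [h [a [_ hi hj _]]] := separating_unit_functional bK sK sepc ij.
  by move: hi hj; rewrite cij; lra.
Qed.

(** * Linear algebra of dependencies and dual bases *)

Lemma linear_dependency (R : fieldType) (V : finType) (d : nat)
    (x : V -> 'rV[R]_d) (T : {set V}) :
  (d < #|T|)%N -> exists l : V -> R,
    [/\ forall p, p \notin T -> l p = 0, \sum_p l p *: x p = 0
      & exists p, l p != 0].
Proof.
move=> dT; pose M := \matrix_(i < #|T|) x (enum_val i).
have /rowV0Pn[w /sub_kermxP wM w0] : kermx M != 0.
  by rewrite kermx_eq0 /row_free neq_ltn (leq_ltn_trans (rank_leq_col M)).
pose l p := \sum_(i | enum_val i == p) w ord0 i.
have [i wi] : exists i, w ord0 i != 0.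
  have [//|all0] := pselect (exists i, w ord0 i != 0).
  case/eqP: w0; apply/rowP => i; rewrite mxE; apply/eqP/negPn/negP => wi.
  by apply: all0; exists i.
exists l; split.
- move=> p pT; apply: big1 => j /eqP jp; case/negP: pT; rewrite -jp; exact: enum_valP.
- rewrite -[RHS]wM mulmx_sum_row.
  rewrite (partition_big (fun i : 'I_#|T| => enum_val i) xpredT) //=.
  apply: eq_bigr => p _; rewrite scaler_suml; apply: eq_bigr => j /eqP <-.
  by rewrite rowK.
- exists (enum_val i); rewrite /l (eq_bigl (pred1 i)) ?big_pred1_eq // => j.
  by rewrite /= (inj_eq enum_val_inj).
Qed.

(** The matrices of the g h and of the x h are inverse to each other,
    up to transposition. *)
Lemma dual_frame_separates (R : realType) (V : finType) (d : nat)
    (g x : V -> 'rV[R]_d) (H : {set V}) (z : 'rV[R]_d) :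
  #|H| = d -> (forall h, h \in H -> dot (g h) (x h) = 1) ->
  (forall h k, h \in H -> k \in H -> h != k -> dot (g h) (x k) = 0) ->
  (forall h, h \in H -> dot (g h) z = 0) -> z = 0.
Proof.
move=> cH diag off gz; pose e (i : 'I_d) : V := enum_val (cast_ord (esym cH) i).
have eH i : e i \in H by apply: enum_valP.
have einj : injective e by move=> i j /enum_val_inj/cast_ord_inj.
pose G := \matrix_(i < d) g (e i); pose X := \matrix_(i < d) x (e i).
have GX : G *m X^T = 1%:M.
  apply/matrixP => i j; rewrite !mxE -[LHS]/(\sum_k _).
  rewrite (eq_bigr (fun k => g (e i) ord0 k * x (e j) ord0 k)) => [|k _];
    last by rewrite !mxE.
  rewrite -/(dot _ _); have [->|ij] := eqVneq i j; first by rewrite diag.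
  by rewrite off // (inj_eq einj).
have Gz : G *m z^T = 0.
  apply/matrixP => i j; rewrite !mxE.
  rewrite (eq_bigr (fun k => g (e i) ord0 k * z ord0 k)) => [|k _];
    last by rewrite !mxE ord1.
  by rewrite -/(dot _ _) gz.
apply: trmx_inj; rewrite trmx0 -[LHS]mul1mx -(mulmx1C GX) -mulmxA Gz mulmx0 //.
Qed.

(** * Vertices with 2d neighbours *)

Definition nbrs (n : nat) (adj : rel 'I_n) (v : 'I_n) : {set 'I_n} :=
  finset (adj v).

Definition local_form (R : realType) (d n : nat) (c : 'I_n -> 'rV[R]_d)
    (f : 'I_n -> 'I_n -> 'rV[R]_d) (v p q : 'I_n) : R :=
  dot (f v p) (direction c v q).

Lemma local_obtuse (R : realType) (d n : nat) (c : 'I_n -> 'rV[R]_d)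
    (adj : rel 'I_n) (f : 'I_n -> 'I_n -> 'rV[R]_d) (v : 'I_n) :
  contact_system c adj f -> obtuse_system (local_form c f v) (nbrs adj v).
Proof.
move=> cs; split=> [p|p q|p q|p q]; rewrite !inE.
- exact: cf_diag.
- by move=> vp vq pq; apply: (cf_le0 cs).
- move=> vp vq; rewrite /local_form directionN dotNr lerN2.
  by apply: (cf_le1 cs) => //; rewrite (adj_sym cs).
- move=> vp vq; rewrite /local_form directionN dotNr => /oppr_inj e k _.
  have qv : adj q v by rewrite (adj_sym cs).
  by rewrite (cf_sym cs qv) (cf_uniq cs vp qv e) dotNl.
Qed.

Lemma local_rank (R : realType) (d n : nat) (c : 'I_n -> 'rV[R]_d)
    (adj : rel 'I_n) (f : 'I_n -> 'I_n -> 'rV[R]_d) (v : 'I_n) :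
  rank_le (local_form c f v) (nbrs adj v) d.
Proof.
move=> T _ dT; have [l [l0 lsum lnz]] := linear_dependency (direction c v) dT.
exists l => //; split=> // p _.
transitivity (dot (f v p) (\sum_q l q *: direction c v q)).
  have dot_sum (s : seq 'I_n) : \sum_(q <- s) local_form c f v p q * l q =
      dot (f v p) (\sum_(q <- s) l q *: direction c v q).
    elim: s => [|q s IHs]; last by rewrite !big_cons IHs dotDr dotZr mulrC.
    by rewrite !big_nil dotr0.
  exact: dot_sum.
by rewrite lsum dotr0.
Qed.

Definition full (d n : nat) (adj : rel 'I_n) (v : 'I_n) : bool :=
  #|nbrs adj v| == d.*2.

Lemma degree_le (R : realType) (d n : nat) (c : 'I_n -> 'rV[R]_d)
    (adj : rel 'I_n) (f : 'I_n -> 'I_n -> 'rV[R]_d) (v : 'I_n) :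
  contact_system c adj f -> (d <= 4)%N -> (#|nbrs adj v| <= d.*2)%N.
Proof.
move=> cs d4.
by have [] := obtuse_cross_polytope (local_obtuse v cs) (@local_rank R d n c adj f v) d4.
Qed.

(** The neighbours of v form the vertices of a cross-polytope, and H selects one
    of each opposite pair.  The functionals of H and its directions are dual
    bases, so that a vector is determined by its values on H. *)
Record cross_frame (R : realType) (d n : nat) (c : 'I_n -> 'rV[R]_d)
    (adj : rel 'I_n) (f : 'I_n -> 'I_n -> 'rV[R]_d) (v : 'I_n)
    (H : {set 'I_n}) : Prop := CrossFrame {
  cross_adj : forall h, h \in H -> adj v h;
  cross_card : #|H| = d;
  cross_opp : forall p, adj v p -> exists2 q, adj v q & f v q = - f v p;
  cross_dual : forall h k, h \in H -> k \in H -> h != k ->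
    dot (f v h) (direction c v k) = 0;
  cross_sep : forall z, (forall h, h \in H -> dot (f v h) z = 0) -> z = 0 }.

Lemma full_cross_frame (R : realType) (d n : nat) (c : 'I_n -> 'rV[R]_d)
    (adj : rel 'I_n) (f : 'I_n -> 'I_n -> 'rV[R]_d) (v : 'I_n) :
  contact_system c adj f -> (d <= 4)%N -> full d adj v ->
  exists H, cross_frame c adj f v H.
Proof.
move=> cs d4 /eqP fv.
have [_ /(_ fv)[opp [H [HS cH orth]]]] :=
  obtuse_cross_polytope (local_obtuse v cs) (@local_rank R d n c adj f v) d4.
have Hadj h : h \in H -> adj v h by move=> /(fintype.subsetP HS); rewrite inE.
exists H; split=> //.
- move=> p vp; have [|q] := opp p; first by rewrite inE.
  rewrite inE => vq; rewrite /local_form directionN dotNr => /oppr_inj e.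
  have qv : adj q v by rewrite (adj_sym cs).
  by exists q => //; rewrite (cf_sym cs qv) (cf_uniq cs vp qv e).
- move=> z; apply: (@dual_frame_separates _ _ _ (f v) (direction c v)) => //.
  by move=> h hH; apply: (cf_diag cs); apply: Hadj.
Qed.

Lemma functional_inj (R : realType) (d n : nat) (c : 'I_n -> 'rV[R]_d)
    (adj : rel 'I_n) (f : 'I_n -> 'I_n -> 'rV[R]_d) (v p q : 'I_n) :
  contact_system c adj f -> adj v p -> adj v q -> f v p = f v q -> p = q.
Proof.
move=> cs vp vq e; apply/eqP/negPn/negP => pq.
by have := cf_le0 cs vp vq pq; rewrite e (cf_diag cs vq); lra.
Qed.

Lemma cross_dot0 (R : realType) (d n : nat) (c : 'I_n -> 'rV[R]_d)
    (adj : rel 'I_n) (f : 'I_n -> 'I_n -> 'rV[R]_d) (v p q : 'I_n)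
    (H : {set 'I_n}) :
  contact_system c adj f -> cross_frame c adj f v H -> adj v p -> adj v q ->
  p != q -> f v q != - f v p -> dot (f v p) (direction c v q) = 0.
Proof.
move=> cs fr vp vq pq fq; have [r vr fr'] := cross_opp fr vp.
have rq : r != q by apply: contraNneq fq => <-; rewrite fr'.
have := cf_le0 cs vr vq rq; have := cf_le0 cs vp vq pq.
by rewrite fr' dotNl; lra.
Qed.

Lemma cross_eq (R : realType) (d n : nat) (c : 'I_n -> 'rV[R]_d)
    (adj : rel 'I_n) (f : 'I_n -> 'I_n -> 'rV[R]_d) (v : 'I_n)
    (H : {set 'I_n}) (x y : 'rV[R]_d) :
  cross_frame c adj f v H ->
  (forall h, h \in H -> dot (f v h) x = dot (f v h) y) -> x = y.
Proof.
move=> fr xy; apply/eqP; rewrite -subr_eq0; apply/eqP/(cross_sep fr) => h hH.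
by rewrite dotBr xy // subrr.
Qed.

Lemma cross_directionN (R : realType) (d n : nat) (c : 'I_n -> 'rV[R]_d)
    (adj : rel 'I_n) (f : 'I_n -> 'I_n -> 'rV[R]_d) (v p q : 'I_n)
    (H : {set 'I_n}) :
  contact_system c adj f -> cross_frame c adj f v H -> adj v p -> adj v q ->
  f v q = - f v p -> direction c v q = - direction c v p.
Proof.
move=> cs fr vp vq fq; apply: (cross_eq fr) => h hH.
have vh := cross_adj fr hH; rewrite dotNr.
have [->|hp] := eqVneq h p.
  by rewrite (cf_diag cs vp) -[f v p]opprK -fq dotNl (cf_diag cs vq).
have [->|hq] := eqVneq h q.
  by rewrite (cf_diag cs vq) fq dotNl (cf_diag cs vp) opprK.
rewrite !(cross_dot0 cs fr) ?oppr0 // ?fq.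
- by apply: contraNneq hq => e; apply/eqP/(functional_inj cs vh vq); rewrite fq e opprK.
- by apply: contraNneq hp => /oppr_inj e; apply/eqP/(functional_inj cs vh vp).
Qed.

Definition directions (R : realType) (d n : nat) (c : 'I_n -> 'rV[R]_d)
    (adj : rel 'I_n) (v : 'I_n) : set 'rV[R]_d :=
  [set x | exists2 p, adj v p & x = direction c v p].

Lemma directionsN (R : realType) (d n : nat) (c : 'I_n -> 'rV[R]_d)
    (adj : rel 'I_n) (f : 'I_n -> 'I_n -> 'rV[R]_d) (v : 'I_n)
    (H : {set 'I_n}) (x : 'rV[R]_d) :
  contact_system c adj f -> cross_frame c adj f v H ->
  directions c adj v x -> directions c adj v (- x).
Proof.
move=> cs fr [p vp ->]; have [q vq fq] := cross_opp fr vp.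
by exists q => //; rewrite (cross_directionN cs fr vp vq fq).
Qed.

(** Let y be a direction at the neighbour w of v.  The hyperplanes of v parallel
    to the edge v w are tangent to the member w as well, and they may not cut
    the next member in the direction y; so the functionals of v take only the
    values 0, 1 and -1 at y.  If one of them is 1 at y, it is the functional of
    y by smoothness, so the others vanish and y agrees with the direction at v
    that belongs to it. *)
Lemma directions_sub (R : realType) (d n : nat) (c : 'I_n -> 'rV[R]_d)
    (adj : rel 'I_n) (f : 'I_n -> 'I_n -> 'rV[R]_d) (v w : 'I_n)
    (H H' : {set 'I_n}) :
  contact_system c adj f -> cross_frame c adj f v H ->
  cross_frame c adj f w H' -> adj v w ->
  directions c adj w `<=` directions c adj v.
Proof.
move=> cs fr fr' vw x [u wu ->]; set y := direction c w u.
have wv : adj w v by rewrite (adj_sym cs).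
have vxw : directions c adj v (direction c v w) by exists w.
have [vu|uv] := eqVneq v u.
  by rewrite /y -vu directionN; apply: directionsN cs fr vxw.
have [fu|fu] := eqVneq (f w u) (- f w v).
  have -> : y = direction c v w.
    by rewrite /y (cross_directionN cs fr' wv wu fu) -directionN.
  by [].
have fwy : dot (f v w) y = 0.
  rewrite (cf_sym cs wv) dotNl (cross_dot0 cs fr') ?oppr0 //.
have gap p : adj v p -> dot (f v p) (direction c v w) = 0 ->
    dot (f v p) y <= 0 \/ 1 <= dot (f v p) y.
  move=> vp pw; have := cf_gap cs u vp.
  by rewrite (direction_add c v w u) dotDr pw add0r.
have val p : adj v p ->
    [\/ dot (f v p) y = 0, dot (f v p) y = 1 | dot (f v p) y = -1].
  move=> vp; have [pw|pw] := eqVneq p w; first by rewrite pw; apply: Or31.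
  have [q vq fq] := cross_opp fr vp.
  have [fw|fw] := eqVneq (f v w) (- f v p).
    by apply: Or31; apply: oppr_inj; rewrite -dotNl -fw oppr0.
  have p0 := cross_dot0 cs fr vp vw pw fw.
  have := gap p vp p0; have := gap q vq; rewrite fq !dotNl p0 oppr0 => /(_ erefl).
  have := cf_le1 cs vp wu; have := cf_le1 cs vq wu; rewrite fq dotNl -/y.
  move=> a b [a'|a'] [b'|b']; [apply: Or31|apply: Or32|apply: Or33|]; lra.
have [p vp py] : exists2 p, adj v p & dot (f v p) y = 1.
  have [[h hH hy]|none] := pselect (exists2 h, h \in H & dot (f v h) y != 0).
    have vh := cross_adj fr hH.
    case: (val h vh) => [h0|h1|hN1]; first by rewrite h0 eqxx in hy.
      by exists h.
    have [q vq fq] := cross_opp fr vh.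
    by exists q => //; rewrite fq dotNl hN1 opprK.
  have y0 : y = 0.
    apply: (cross_sep fr) => h hH; apply/eqP/negPn/negP => hy; apply: none.
    by exists h.
  by have := cf_diag cs wu; rewrite -/y y0 dotr0; lra.
have fwu := cf_uniq cs vp wu py.
exists p => //; apply: (cross_eq fr) => h hH; have vh := cross_adj fr hH.
case: (val h vh) => hy.
- rewrite hy (cross_dot0 cs fr) //.
    by apply/eqP => hp; move: hy; rewrite hp py; lra.
  by apply/eqP => fp; move: py; rewrite fp dotNl hy; lra.
- have e := cf_uniq cs vh wu hy.
  rewrite hy; have -> : h = p by apply: (functional_inj cs vh vp); rewrite -e fwu.
  by rewrite (cf_diag cs vp).
- have [q vq fq] := cross_opp fr vh.
  have qy : dot (f v q) y = 1 by rewrite fq dotNl hy opprK.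
  have e := cf_uniq cs vq wu qy.
  have qp : q = p by apply: (functional_inj cs vq vp); rewrite -e fwu.
  have fh : f v h = - f v p by rewrite -qp fq opprK.
  by rewrite hy fh dotNl (cf_diag cs vp).
Qed.

Lemma directions_full_adj (R : realType) (d n : nat) (c : 'I_n -> 'rV[R]_d)
    (adj : rel 'I_n) (f : 'I_n -> 'I_n -> 'rV[R]_d) (v w : 'I_n) :
  contact_system c adj f -> (d <= 4)%N -> full d adj v -> full d adj w ->
  adj v w -> directions c adj v = directions c adj w.
Proof.
move=> cs d4 fv fw vw; have wv : adj w v by rewrite (adj_sym cs).
have [H fr] := full_cross_frame cs d4 fv.
have [H' fr'] := full_cross_frame cs d4 fw.
apply/seteqP; split; [exact: directions_sub cs fr' fr wv|].
exact: directions_sub cs fr fr' vw.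
Qed.

(** * Boundary of a parallel class *)

Definition parallel_class (R : realType) (d n : nat) (c : 'I_n -> 'rV[R]_d)
    (adj : rel 'I_n) (v : 'I_n) : {set 'I_n} :=
  finset (fun w => full d adj w && (directions c adj w == directions c adj v)).

Definition open_nbrs (d n : nat) (adj : rel 'I_n) (v : 'I_n) : {set 'I_n} :=
  finset (fun p => adj v p && ~~ full d adj p).

(** The next member p in the direction [s *: direction c v0 h] lies on the same
    line and further out, so it is not in the class of v; as adjacent full
    vertices are in the same class, p is not full.  The sign s, equal to 1 or
    -1, treats both ends of the line at once. *)
Lemma extremal_open_nbr (R : realType) (d n : nat) (c : 'I_n -> 'rV[R]_d)
    (adj : rel 'I_n) (f : 'I_n -> 'I_n -> 'rV[R]_d) (v0 v h : 'I_n)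
    (H : {set 'I_n}) (s : R) :
  contact_system c adj f -> (d <= 4)%N -> cross_frame c adj f v0 H ->
  s = 1 \/ s = -1 -> h \in H -> v \in parallel_class c adj v0 ->
  topmost (fun w k => s * dot (f v0 k) (c w)) H (parallel_class c adj v0) h v ->
  exists2 p, p \in open_nbrs d adj v & direction c v p = s *: direction c v0 h.
Proof.
move=> cs d4 fr s1 hH; rewrite inE => /andP[fv /eqP dv] /topmostP top.
have v0h := cross_adj fr hH.
have [p vp pE] : directions c adj v (s *: direction c v0 h).
  rewrite dv; have x0 : directions c adj v0 (direction c v0 h) by exists h.
  by case: s1 => ->; rewrite ?scale1r // scaleN1r; apply: directionsN cs fr x0.
have cp : c p = c v + 2 *: (s *: direction c v0 h).
  by rewrite pE /direction scalerA divff // scale1r addrC subrK.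
exists p => //; rewrite inE vp; apply/negP => fp.
have pC : p \in parallel_class c adj v0.
  by rewrite inE fp -(directions_full_adj cs d4 fv fp vp) dv eqxx.
have : ~ (s * dot (f v0 h) (c p) <= s * dot (f v0 h) (c v)).
  rewrite cp dotDr 2!dotZr (cf_diag cs v0h).
  by case: s1 => ->; lra.
apply; apply: top => //; apply/same_lineP => k kH kh.
by rewrite cp dotDr 2!dotZr (cross_dual fr kH hH kh) !mulr0 addr0.
Qed.

Lemma direction_inj (R : realType) (d n : nat) (c : 'I_n -> 'rV[R]_d)
    (v : 'I_n) : injective c -> injective (direction c v).
Proof.
move=> cinj p q /(congr1 (fun x => 2 *: x)).
by rewrite /direction !scalerA divff // !scale1r => /addIr/cinj.
Qed.

Definition extremal_axes (R : realType) (d n : nat) (c : 'I_n -> 'rV[R]_d)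
    (adj : rel 'I_n) (f : 'I_n -> 'I_n -> 'rV[R]_d) (v0 : 'I_n)
    (H : {set 'I_n}) (s : R) (v : 'I_n) : {set 'I_n} :=
  finset (fun h => (h \in H) && topmost (fun w k => s * dot (f v0 k) (c w)) H
    (parallel_class c adj v0) h v).

(** The neighbours found at the two ends of the lines through v are distinct, as
    their directions are. *)
Lemma card_open_nbrs (R : realType) (d n : nat) (c : 'I_n -> 'rV[R]_d)
    (adj : rel 'I_n) (f : 'I_n -> 'I_n -> 'rV[R]_d) (v0 v : 'I_n)
    (H : {set 'I_n}) :
  contact_system c adj f -> (d <= 4)%N -> cross_frame c adj f v0 H ->
  v \in parallel_class c adj v0 ->
  (#|extremal_axes c adj f v0 H 1%R v| + #|extremal_axes c adj f v0 H (-1)%R v|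
    <= #|open_nbrs d adj v|)%N.
Proof.
move=> cs d4 fr vC; pose tops s := extremal_axes c adj f v0 H s v.
pose g (s : R) h := odflt v
  [pick p in open_nbrs d adj v | direction c v p == s *: direction c v0 h].
have gP s h : s = 1 \/ s = -1 -> h \in tops s ->
    g s h \in open_nbrs d adj v /\ direction c v (g s h) = s *: direction c v0 h.
  move=> s1; rewrite inE => /andP[hH /(extremal_open_nbr cs d4 fr s1 hH vC)[p po pE]].
  rewrite /g; case: pickP => [q /andP[qo /eqP]//|/(_ p)].
  by rewrite po pE eqxx.
have card_g s : s = 1 \/ s = -1 -> #|[set g s h | h in tops s]%SET| = #|tops s|.
  move=> s1; apply: card_in_imset => h k ht kt e.
  have [_ eh] := gP s h s1 ht; have [_ ek] := gP s k s1 kt.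
  apply: (direction_inj (cs_inj cs) (v := v0)).
  apply: (@scalerI _ _ s); last by rewrite -eh -ek e.
  by case: s1 => ->; rewrite ?oppr_eq0 oner_eq0.
have one : (1 : R) = 1 \/ (1 : R) = -1 by left.
have mone : (-1 : R) = 1 \/ (-1 : R) = -1 by right.
rewrite -/(tops 1) -/(tops (-1)) -(card_g 1 one) -(card_g (-1) mone).
set P := imset _ _; set Q := imset _ _.
have PQ : P :&: Q = finset.set0.
  apply/setP => p; rewrite finset.in_setI finset.in_set0.
  apply/negP => /andP[/imsetP[h ht pg] /imsetP[k kt pg']].
  have [_ eh] := gP _ h one ht; have [_ ek] := gP _ k mone kt.
  move: eh; rewrite -pg pg' ek scaleN1r scale1r => hk.
  have hH : h \in H by move: ht; rewrite inE => /andP[].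
  have kH : k \in H by move: kt; rewrite inE => /andP[].
  have := cf_diag cs (cross_adj fr hH); rewrite -hk dotNr.
  have [->|hk'] := eqVneq h k; first by rewrite (cf_diag cs (cross_adj fr kH)); lra.
  by rewrite (cross_dual fr hH kH hk'); lra.
have -> : (#|P| + #|Q|)%N = #|P :|: Q| by rewrite cardsU PQ cards0 subn0.
apply/subset_leq_card/fintype.subsetP => p; rewrite finset.in_setU.
by case/orP => /imsetP[h ht ->]; apply: (gP _ _ _ ht).1.
Qed.

(** The isoperimetric inequality is applied twice, to the coordinates and to
    their negatives, for the upper and the lower ends of the lines. *)
Lemma class_boundary (R : realType) (k n : nat) (c : 'I_n -> 'rV[R]_k.+1)
    (adj : rel 'I_n) (f : 'I_n -> 'I_n -> 'rV[R]_k.+1) (v0 : 'I_n) :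
  contact_system c adj f -> (k < 4)%N -> full k.+1 adj v0 ->
  2 * #|parallel_class c adj v0|%:R `^ (k%:R / k.+1%:R)
    <= (\sum_(v in parallel_class c adj v0) #|open_nbrs k.+1 adj v|)%:R :> R.
Proof.
move=> cs d4 fv0; have [H fr] := full_cross_frame cs d4 fv0.
set C := parallel_class c adj v0.
have C0 : C != finset.set0.
  by apply/finset.set0Pn; exists v0; rewrite inE fv0 eqxx.
pose phi (s : R) w h := s * dot (f v0 h) (c w).
have inj s : s != 0 -> coordinates_on (phi s) H C.
  move=> s0 v w _ _ e; apply: (cs_inj cs); apply: (cross_eq fr) => h hH.
  by apply: (mulfI s0); apply: e.
have iso s : s != 0 -> _ := fun s0 => tops_isoperimetry (cross_card fr) C0 (inj s s0).
have iso1 := iso 1 (oner_neq0 _).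
have isoN : _ := iso (-1) _.
rewrite mulr_natl mulr2n; apply: le_trans (lerD iso1 (isoN _)) _.
  by rewrite oppr_eq0 oner_eq0.
rewrite -natrD ler_nat -big_split /=; apply: leq_sum => v vC.
exact: card_open_nbrs.
Qed.

(** * Counting contacts *)

Definition full_set (d n : nat) (adj : rel 'I_n) : {set 'I_n} :=
  finset (full d adj).

(** Summing [class_boundary] over the classes loses nothing: by
    [powR_self_bound] each full vertex of a class contributes on average at
    least the same weight, computed from the total number N of full vertices. *)
Lemma full_boundary (R : realType) (k n : nat) (c : 'I_n -> 'rV[R]_k.+1)
    (adj : rel 'I_n) (f : 'I_n -> 'I_n -> 'rV[R]_k.+1) :
  contact_system c adj f -> (k < 4)%N -> (0 < #|full_set k.+1 adj|)%N ->
  2 * #|full_set k.+1 adj|%:R `^ (k%:R / k.+1%:R)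
    <= (\sum_(v in full_set k.+1 adj) #|open_nbrs k.+1 adj v|)%:R :> R.
Proof.
move=> cs k4; set F := full_set k.+1 adj => F0; pose N : R := #|F|%:R.
rewrite -/N powR_card_sum // mulr_sumr.
rewrite natr_sum; apply: (ler_sum_fibers (h := directions c adj)) => u uF.
have fu : full k.+1 adj u by move: uF; rewrite inE.
have classE v : (v \in F) && (directions c adj v == directions c adj u) =
    (v \in parallel_class c adj u) by rewrite !inE.
rewrite !(eq_bigl _ _ classE) sumr_const -[leLHS]mulr_natl mulrCA.
rewrite -natr_sum; apply: le_trans (class_boundary cs k4 fu).
rewrite ler_wpM2l // powR_self_bound //.
  by rewrite ltr0n; apply/card_gt0P; exists u; rewrite inE fu eqxx.
rewrite ler_nat; apply/subset_leq_card/fintype.subsetP => v.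
by rewrite !inE => /andP[].
Qed.

(** Double counting of the edges between full and other vertices; the latter have
    degree at most 2d - 1. *)
Lemma open_boundary_le (R : realType) (d n : nat) (c : 'I_n -> 'rV[R]_d)
    (adj : rel 'I_n) (f : 'I_n -> 'I_n -> 'rV[R]_d) :
  contact_system c adj f -> (d <= 4)%N ->
  (\sum_(v in full_set d adj) #|open_nbrs d adj v|
    <= #|finset.setC (full_set d adj)| * d.*2.-1)%N.
Proof.
move=> cs d4; set F := full_set d adj.
have -> : (\sum_(v in F) #|open_nbrs d adj v| =
    \sum_(p in finset.setC F) \sum_(v in F | adj v p) 1)%N.
  rewrite (exchange_big_dep (mem F)) /=; last by move=> p v _ /andP[].
  apply: eq_bigr => v vF; rewrite -sum1_card; apply: eq_bigl => p.
  by rewrite vF !inE andbC.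
rewrite -sum_nat_const; apply: leq_sum => p; rewrite !inE => pF.
have dp : (#|nbrs adj p| < d.*2)%N.
  by rewrite ltn_neqAle pF (degree_le _ cs d4).
apply: (@leq_trans #|nbrs adj p|); last by lia.
rewrite sum1dep_card; apply/subset_leq_card/fintype.subsetP => v.
by rewrite !inE => /andP[_]; rewrite (adj_sym cs).
Qed.

Lemma sum_degree_le (R : realType) (d n : nat) (c : 'I_n -> 'rV[R]_d)
    (adj : rel 'I_n) (f : 'I_n -> 'I_n -> 'rV[R]_d) :
  contact_system c adj f -> (d <= 4)%N ->
  (\sum_v #|nbrs adj v| + #|finset.setC (full_set d adj)| <= d.*2 * n)%N.
Proof.
move=> cs d4; rewrite -sum1_card [X in (_ + X)%N]big_mkcond -big_split /=.
apply: (@leq_trans (\sum_(v < n) d.*2)); last by rewrite sum_nat_const card_ord mulnC.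
apply: leq_sum => v _; rewrite !inE; have := degree_le v cs d4.
by rewrite /full; case: eqP => /=; lia.
Qed.

Lemma handshake (R : realType) (d n : nat) (K : set 'rV[R]_d)
    (c : 'I_n -> 'rV[R]_d) :
  (\sum_v #|nbrs (contact K c) v| = (contact_number K c).*2)%N.
Proof.
have tsym i j : `[< touch K c i j >] = `[< touch K c j i >].
  by apply: asbool_equiv_eq; rewrite /touch setIC.
pose up := \sum_(p : 'I_n) \sum_(q : 'I_n) (contact K c p q && (p < q)%N : nat).
have edgesE : contact_number K c = up.
  rewrite /contact_number -sum1_card big_mkcond /= /up pair_big /=.
  apply: eq_bigr => -[p q] _; rewrite inE /= /contact.
  have [->|pq] := eqVneq p q; first by rewrite ltnn.
  by rewrite /= andbC; case: ifP.
have degE v : #|nbrs (contact K c) v| = (\sum_q (contact K c v q && (v < q)%N : nat) +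
    \sum_q (contact K c v q && (q < v)%N : nat))%N.
  rewrite -big_split /= -sum1_card big_mkcond /=; apply: eq_bigr => q _.
  rewrite inE /contact -val_eqE /=; case: ltngtP => //=; rewrite ?andbF //.
    by case: asbool.
  by case: asbool.
under eq_bigr => v _ do rewrite degE.
rewrite big_split /= -/up edgesE -addnn; congr (_ + _)%N.
rewrite exchange_big /=; apply: eq_bigr => p _; apply: eq_bigr => q _.
by rewrite /contact eq_sym tsym.
Qed.

Lemma csep_le (R : realType) (d n : nat) (K : set 'rV[R]_d) (x : R) :
  0 <= x ->
  (forall c : 'I_n -> 'rV[R]_d, totally_separable_packing K c ->
     (contact_number K c)%:R <= x) ->
  (csep K n)%:R <= x.
Proof.
move=> x0 bound; rewrite /csep; elim/big_ind: _ => //.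
- by move=> a b ax bx; rewrite /maxn; case: ifP.
- by move=> E /asboolP[c cK <-]; apply: bound.
Qed.

Lemma contact_number_count (R : realType) (k n : nat) (K : set 'rV[R]_k.+1)
    (c : 'I_n -> 'rV[R]_k.+1) :
  (k < 4)%N -> convex_body K -> o_symmetric K -> smooth K ->
  totally_separable K c ->
  exists N b : nat, [/\ (N + b = n)%N,
    ((contact_number K c).*2 + b <= k.+1.*2 * n)%N &
    (0 < N)%N -> 2 * N%:R `^ (k%:R / k.+1%:R) <= (b * k.+1.*2.-1)%:R :> R].
Proof.
move=> k4 bK sK smK sepc.
have [f cs] := contact_system_exists bK sK smK sepc.
exists #|full_set k.+1 (contact K c)|.
exists #|finset.setC (full_set k.+1 (contact K c))|; split.
- by rewrite cardsC card_ord.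
- by rewrite -handshake (sum_degree_le cs k4).
- move=> N0; apply: le_trans (full_boundary cs k4 N0) _.
  by rewrite ler_nat (open_boundary_le cs k4).
Qed.

(** If b is less than n / 2, then N is more than n / 2 and
    N^s >= (n/2)^s >= n^s / 2. *)
Lemma boundary_count_powR (R : realType) (k N b n : nat) :
  (1 < n)%N -> (N + b = n)%N ->
  ((0 < N)%N -> 2 * N%:R `^ (k%:R / k.+1%:R) <= (b * k.+1.*2.-1)%:R :> R) ->
  n%:R `^ (k%:R / k.+1%:R) <= (k.+1.*2 * b)%:R :> R.
Proof.
move=> n1 Nb iso; set s := k%:R / k.+1%:R.
have s0 : 0 <= s by rewrite divr_ge0.
have s1 : s <= 1 by rewrite ler_pdivrMr // mul1r ler_nat.
have [nb|bn] := leqP n b.*2.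
  apply: (@le_trans _ _ n%:R); last by rewrite ler_nat; nia.
  rewrite -{2}[n%:R]powRr1 // ler_powR // ler1n; exact: ltnW.
have N0 : (0 < N)%N by lia.
have nN : (n%:R : R) / 2 <= N%:R.
  by rewrite ler_pdivrMr // -natrM ler_nat; lia.
have half : 2^-1 <= 2^-1 `^ s :> R.
  rewrite -{1}[2^-1 : R]powRr1 //.
  by rewrite ger_powR // invr_gt0 ltr0n /=; lra.
apply: (@le_trans _ _ (2 * N%:R `^ s)).
  apply: (@le_trans _ _ (2 * (n%:R / 2) `^ s)).
    by rewrite powRM // mulrCA ler_peMr ?powR_ge0 // -ler_pdivrMl // mulr1.
  by rewrite ler_wpM2l // ge0_ler_powR // ?nnegrE ?divr_ge0.
by rewrite (le_trans (iso N0)) // ler_nat; nia.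
Qed.

(** From 4 N <= 9 b^2 and 4 b^2 < n one gets 4 n <= 9 b^2 + 4 b < 9 n / 4 + 4 b,
    so b > 7 n / 16; for n at least 2 this contradicts 4 b^2 < n. *)
Lemma boundary_count_plane (R : realType) (N b n : nat) :
  (1 < n)%N -> (N + b = n)%N ->
  ((0 < N)%N -> 2 * N%:R `^ (1 / 2) <= (b * 3)%:R :> R) ->
  Num.sqrt n%:R <= 2 * b%:R :> R.
Proof.
move=> n1 Nb iso.
have b0 : 0 <= b%:R :> R by [].
have n2 : 2 <= n%:R :> R by rewrite ler_nat.
have NE : (N%:R : R) = n%:R - b%:R by rewrite -Nb natrD addrK.
have sq : 4 * N%:R <= 9 * b%:R ^+ 2 :> R.
  have [N0|] := posnP N; first by rewrite N0 mulr0 mulr_ge0 // sqr_ge0.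
  move=> /iso; rewrite div1r powR12_sqrt // natrM => h.
  have := sqr_sqrtr (ler0n R N); have := sqrtr_ge0 (N%:R : R).
  by nra.
rewrite leNgt; apply/negP => lt.
have lt2 : 4 * b%:R ^+ 2 < n%:R :> R.
  have := sqr_sqrtr (ler0n R n); have := sqrtr_ge0 (n%:R : R).
  by nra.
have b7 : 7 * n%:R < 16 * b%:R :> R by lra.
clear -b0 n2 lt2 b7; nra.
Qed.

Theorem theorem3 (R : realType) :
  (forall (d : nat) (K : set 'rV[R]_d),
     d \in [:: 1%N; 2%N; 3%N; 4%N] ->
     convex_body K -> o_symmetric K -> smooth K ->
     exists2 f : R, 0 < f &
       forall n : nat, (1 < n)%N ->
         (csep K n)%:R <=
           d%:R * n%:R - n%:R `^ ((d%:R - 1) / d%:R) * f)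
  /\
  (forall K : set 'rV[R]_2,
     convex_body K -> o_symmetric K -> smooth K ->
     forall n : nat, (1 < n)%N ->
       (csep K n)%:R <=
         2 * n%:R - Num.sqrt pi / 8 * Num.sqrt n%:R :> R).
Proof.
split=> [[|k]// K k4 bK sK smK|K bK sK smK n n1].
  have {}k4 : (k < 4)%N by move: k4; rewrite !inE; lia.
  have -> : (k.+1%:R - 1 : R) = k%:R by rewrite -natr1 addrK.
  pose m : R := k.+1%:R.
  have m0 : 0 < m by rewrite ltr0n.
  exists (4 * m)^-1 => [|n n1]; first by rewrite invr_gt0 mulr_gt0.
  set s := k%:R / k.+1%:R.
  apply: csep_le => [|c [_ sepc]].
    have ns : n%:R `^ s <= n%:R :> R.
      rewrite -[leRHS]powRr1 // ler_powR ?ler1n ?(ltnW n1) //.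
      by rewrite /s ler_pdivrMr // mul1r ler_nat.
    rewrite subr_ge0 ler_pdivrMr ?mulr_gt0 //.
    have n0 : 0 <= n%:R :> R by [].
    have m1 : 1 <= m by rewrite ler1n.
    rewrite -/m; nra.
  have [N [b [Nb deg iso]]] := contact_number_count k4 bK sK smK sepc.
  have nb := boundary_count_powR n1 Nb iso.
  have deg' : 2 * (contact_number K c)%:R + b%:R <= 2 * m * n%:R :> R.
    by move: deg; rewrite -(ler_nat R) natrD natrM -!muln2 !natrM !(mulrC _ 2%:R).
  have nb' : n%:R `^ s / (4 * m) <= b%:R / 2.
    rewrite ler_pdivrMr ?mulr_gt0 //; move: nb.
    rewrite -/s natrM -muln2 natrM -/m => /le_trans; apply.
    by rewrite le_eqVlt; apply/orP; left; apply/eqP; field.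
  rewrite lerBrDr -(ler_pM2l (@ltr0Sn R 1)) mulrDr (le_trans _ (le_trans deg' _)) //.
    by rewrite lerD2l mulrC -ler_pdivlMr.
  by rewrite -mulrA.
(* In the plane the crude bound pi <= 4 suffices. *)
have sqpi : Num.sqrt (pi : R) <= 2.
  rewrite -[leRHS]ger0_norm // -sqrtr_sqr ler_wsqrtr //.
  have /andP[_] := pihalf_02 R; lra.
have sqn : 0 <= Num.sqrt (n%:R : R) by exact: sqrtr_ge0.
apply: csep_le => [|c [_ sepc]].
  have n2 : 2 <= n%:R :> R by rewrite ler_nat.
  have := sqr_sqrtr (ler0n R n) => sqE.
  have sq1 : Num.sqrt (n%:R : R) <= n%:R by nra.
  have := sqrtr_ge0 (pi : R); nra.
have [N [b [Nb deg iso]]] := contact_number_count (k := 1) isT bK sK smK sepc.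
have nb := boundary_count_plane n1 Nb iso.
have deg' : 2 * (contact_number K c)%:R + b%:R <= 4 * n%:R :> R.
  by move: deg; rewrite -(ler_nat R) natrD natrM -!muln2 !natrM !(mulrC _ 2%:R); lra.
have := sqrtr_ge0 (pi : R); nra.
Qed.
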